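(* Let $P$ be a natural unit interval order on $[n]$, and let $\lambda^{gr}=\lambda^{gr}(P)$ be its greedy partition. Let $S$ be a subset of $[n]$ that contains no two adjacent (consecutive) integers, and let $k_i$ be a positive integer for each $i\in S$. If $\lambda$ is a partition whose conjugate partition $\lambda'$ satisfies $$\lambda'_i=\begin{cases}\lambda^{gr}_i-k_i&\text{if }i\in S,\\ \lambda^{gr}_i+k_{i-1}&\text{if }i-1\in S,\\ \lambda^{gr}_i&\text{otherwise,}\end{cases}$$ then $$c_\lambda^P(q)=\sum_{T\in\mathrm{strongST}_P(\lambda)}q^{\mathrm{inv}_P(T)}.$$
   Context: A natural unit interval order on $[n]$ is a poset $P$ on $[n]$ for which there are reals $a_1\le\dots\le a_n$ with $i<_Pj\iff a_i+1<a_j$. $\mathrm{inc}(P)$ is the graph on $[n]$ with edges between distinct incomparable elements. For a graph $G$ on $[n]$, $X_G(\mathbf x,q)=\sum_\kappa q^{\mathrm{inv}_G(\kappa)}x_{\kappa(1)}\cdots x_{\kappa(n)}$ over proper colorings $\kappa:[n]\to\mathbb Z_{>0}$, where $\mathrm{inv}_G(\kappa)=\#\{\{i,j\}\in E(G): i<j,\ \kappa(i)>\kappa(j)\}$. For natural unit interval orders $X_{\mathrm{inc}(P)}(\mathbf x,q)$ is symmetric in $\mathbf x$; $c_\lambda^P(q)$ is its coefficient of the elementary symmetric function $e_\lambda(\mathbf x)$. Greedy partition: for a $(\mathbf 3+\mathbf 1)$-free poset $P$ on $n$ elements (in particular for natural unit interval orders), $\lambda^{gr}(P)$ is the unique partition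 of $n$ that is maximum in dominance order among the partitions $\mu\vdash n$ such that $P$ can be partitioned into chains of sizes $\mu_1,\mu_2,\dots$ (it exists by a theorem of Matherne–Morales–Selover). Parts beyond the length of a partition are $0$. Young diagrams are in English convention. A $P$-tableau of shape $\lambda$ is a filling $T:\lambda\to P$ with $T_{i,j}<_P T_{i+1,j}$ and $T_{i,j}\not>_P T_{i,j+1}$. For adjacent columns $C,D$ (each a chain), a ladder is a connected component of the subgraph of $\mathrm{inc}(P)$ induced on $C\cup D$; it is right-unbalanced if it has more elements in the right column $D$ than in the left column $C$. A $P$-tableau is strong if no pair of adjacent columns has a right-unbalanced ladder. $\mathrm{strongST}_P(\lambda)$ is the set of strong $P$-tableaux of shape $\lambda$ in which each element of $P$ appears exactly once. $\mathrm{inv}_P(T)=\#\{(i<j): i,j\text{ incomparable in }P,\ i\text{ appears in a column strictly to the right of the column of }j\text{ in }T\}$. *)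

(* Defs.v *)
From HB Require Import structures.
From mathcomp Require Import all_boot all_order all_algebra.
From mathcomp Require Import reals.
From mathcomp.multinomials Require Import mpoly.

Set Implicit Arguments.
Unset Strict Implicit.
Unset Printing Implicit Defensive.
Import Order.TTheory GRing.Theory Num.Theory.
Local Open Scope ring_scope.

(* The ground set [n] = {1, ..., n} is represented by 'I_n = {0, ..., n-1};   *)
(* rows, columns, parts of partitions and colours are also numbered from 0.   *)

Definition natural_unit_interval_order (R : realType) (n : nat)
    (P : rel 'I_n) : Prop :=
  exists a : 'I_n -> R,
    (forall i j : 'I_n, (i <= j)%N -> a i <= a j) /\
    (forall i j : 'I_n, P i j <-> a i + 1 < a j).

(* P i j stands for i <_P j. *)
Definition inc (n : nat) (P : rel 'I_n) : rel 'I_n :=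
  fun i j => [&& i != j, ~~ P i j & ~~ P j i].

(* A partition of n is padded with zeros to its first n parts (it never has   *)
(* more than n nonzero parts), which makes the partitions of n a finType.     *)
Definition is_intpart (n : nat) (t : n.-tuple 'I_n.+1) : bool :=
  sorted geq [seq val x | x <- t] && (\sum_(x <- t) val x == n)%N.

Record intpart (n : nat) : predArgType := IntPart {
  intpart_tuple :> n.-tuple 'I_n.+1;
  _ : is_intpart intpart_tuple
}.
HB.instance Definition _ n := [isSub for @intpart_tuple n].
HB.instance Definition _ n := [Finite of intpart n by <:].

Definition part (n : nat) (mu : intpart n) (i : nat) : nat :=
  nth ord0 mu i.

Definition parts (n : nat) (mu : intpart n) : seq nat :=
  [seq val x | x <- mu & (0 < val x)%N].

Definition conj_part (n : nat) (mu : intpart n) (j : nat) : nat :=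
  count (fun m => j < m)%N (parts mu).

Definition dominates (n : nat) (mu nu : intpart n) : Prop :=
  forall k : nat, (\sum_(i < k) part nu i <= \sum_(i < k) part mu i)%N.

(* The chromatic quasisymmetric function. A power series of bounded degree in *)
(* x_1, x_2, ... is given by its truncations x_(N+1) = x_(N+2) = ... = 0, for *)
(* all N; the coefficients are polynomials in q = 'X.                         *)
Definition proper_coloring (n N : nat) (G : rel 'I_n)
    (kappa : {ffun 'I_n -> 'I_N}) : bool :=
  [forall i, forall j, G i j ==> (kappa i != kappa j)].

Definition inv_coloring (n N : nat) (G : rel 'I_n)
    (kappa : {ffun 'I_n -> 'I_N}) : nat :=
  #|[set p : 'I_n * 'I_n |
      [&& (p.1 < p.2)%N, G p.1 p.2 & (kappa p.2 < kappa p.1)%N]]|.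

Definition chromatic_qsym (n : nat) (G : rel 'I_n) (N : nat) :
    {mpoly {poly int}[N]} :=
  \sum_(kappa : {ffun 'I_n -> 'I_N} | proper_coloring G kappa)
    ('X^(inv_coloring G kappa) : {poly int}) *: \prod_(i < n) 'X_(kappa i).

Definition elementary (R : comNzRingType) (n : nat) (mu : intpart n)
    (N : nat) : {mpoly R[N]} :=
  \prod_(m <- parts mu) mesym N R m.

(* c gives the coefficients of F, homogeneous symmetric of degree n, in the   *)
(* basis of elementary symmetric functions. The identity is required for all  *)
(* N, i.e. in infinitely many variables, and hence determines c.              *)
Definition e_coefficients (R : comNzRingType) (n : nat)
    (F : forall N : nat, {mpoly R[N]}) (c : intpart n -> R) : Prop :=
  forall N : nat, F N = \sum_(mu : intpart n) c mu *: elementary R mu N.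

Definition is_chain (n : nat) (P : rel 'I_n) (A : {set 'I_n}) : bool :=
  [forall x in A, forall y in A, (x != y) ==> (P x y || P y x)].

Definition chain_partitionable (n : nat) (P : rel 'I_n) (mu : intpart n) :
    Prop :=
  exists C : {set {set 'I_n}},
    [/\ partition C [set: 'I_n],
        {in C, forall A, is_chain P A} &
        perm_eq [seq #|A| | A : {set 'I_n} <- enum C] (parts mu)].

Definition greedy_partition (n : nat) (P : rel 'I_n) (mu : intpart n) : Prop :=
  chain_partitionable P mu /\
  (forall nu : intpart n, chain_partitionable P nu -> dominates mu nu).

Section Tableaux.
Variables (n : nat) (P : rel 'I_n) (la : intpart n).

(* The pair (i, j) is the cell in row i and column j; a partition of n fits   *)
(* in an n by n square.                                                       *)
Definition cell : finType :=
  {c : 'I_n * 'I_n | (c.2 < part la c.1)%N}.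

Definition row_of (c : cell) : nat := (val c).1.
Definition col_of (c : cell) : nat := (val c).2.

Definition filling : finType := {ffun cell -> 'I_n}.

Definition is_Ptableau (T : filling) : bool :=
  [forall c : cell, forall d : cell,
     ((row_of d == (row_of c).+1) && (col_of d == col_of c)
        ==> P (T c) (T d)) &&
     ((row_of d == row_of c) && (col_of d == (col_of c).+1)
        ==> ~~ P (T d) (T c))].

Definition is_standard (T : filling) : bool :=
  [forall x : 'I_n, #|[set c | T c == x]| == 1%N].

Definition column (T : filling) (j : nat) : {set 'I_n} :=
  [set T c | c : cell & col_of c == j].

(* The connected components of inc(P) induced on C :|: D. *)
Definition ladders (C D : {set 'I_n}) : {set {set 'I_n}} :=
  let A := C :|: D in
  equivalence_partition
    (connect (fun x y => [&& x \in A, y \in A & inc P x y])) A.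

Definition right_unbalanced (C D L : {set 'I_n}) : bool :=
  (#|L :&: C| < #|L :&: D|)%N.

Definition is_strong (T : filling) : bool :=
  [forall j : 'I_n,
    [forall L in ladders (column T j) (column T j.+1),
      ~~ right_unbalanced (column T j) (column T j.+1) L]].

Definition strongST : {set filling} :=
  [set T : filling | [&& is_Ptableau T, is_standard T & is_strong T]].

Definition inv_tableau (T : filling) : nat :=
  #|[set p : 'I_n * 'I_n |
      [&& (p.1 < p.2)%N, inc P p.1 p.2 &
          [exists c : cell, exists d : cell,
             [&& T c == p.1, T d == p.2 & (col_of d < col_of c)%N]]]]|.

End Tableaux.

(* Main.v *)
Require Import Defs.
From mathcomp Require Import all_boot all_order all_algebra.
From mathcomp Require Import reals perm.
From mathcomp.multinomials Require Import mpoly.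
From mathcomp Require Import zify.

Set Implicit Arguments.
Unset Strict Implicit.
Unset Printing Implicit Defensive.
Import Order.TTheory GRing.Theory Num.Theory.
Local Open Scope ring_scope.

(** Let X be the chromatic quasisymmetric function of inc(P) and c its
    coefficients in the e-basis. The coefficient of a monomial x^nu in X has two
    expressions. It is the sum of q^inv over the proper colourings of content nu;
    and, expanding the products e_mu, it is the sum of c_mu over the 0-1 matrices
    with column sums nu whose row sums form, in order, a partition mu
    ([e_coefficients_contents]).

    Both families of objects carry flips for two consecutive colours, or columns,
    i and i+1. In a colouring, one exchanges the two colours on an unbalanced
    ladder; in a matrix, one exchanges the entries 01 or 10 of a row. A flip moves
    one unit of content between i and i+1 and keeps the weight: a ladder is a path
    with increasing labels ([ladder_upper]), so on an unbalanced one the flip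
    creates as many inversions as it destroys ([inv_cflip]). Counting twice the
    pairs of an object and one of its flippable components shows that the sums
    over all objects, for all contents, determine the sums over the objects
    without excess of i+1 over i, that is, without right-unbalanced ladder or row
    01 ([flip_sum_determined]). As the pairs {i, i+1} for i in S are disjoint, this
    can be done for all i in S at once ([restricted_sums]).

    The greedy partition evaluates both restricted sums for the content lambda'.
    The classes of a colouring are chains, so the partial sums of its content are
    bounded by those of lambda^gr ([greedy_bound]), and c_mu = 0 unless mu'
    satisfies the same bound ([coefficient_support]). For i outside S, the partial
    sum of lambda' through position i attains the bound. So a contributing matrix
    of content lambda' without row 01 at S is left-justified, and the matrix side
    is c_lambda. Likewise a colouring of content lambda' has no right-unbalanced
    ladder outside S, since flipping it would break the bound
    ([greedy_excess]); the colouring side thus runs over the colourings without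
    any right-unbalanced ladder.

    Such colourings are the strong standard tableaux of shape lambda, with the
    column of an element as its colour ([sum_strong_colourings]): in the absence of
    right-unbalanced ladders, each column is matched into the preceding one by
    incomparable pairs ([matching_of_balanced]), and this implies the row
    condition. *)

(** * Partitions and their conjugates *)

Lemma ltn_count_sorted (s : seq nat) (j r : nat) :
  sorted geq s -> (r < count (fun m => j < m) s)%N = (j < nth 0 s r)%N.
Proof.
elim: s r => [|x s IHs] r /=; first by rewrite nth_nil.
move=> hxs; have hs := path_sorted hxs.
case: (ltnP j x) => hjx.
  by case: r => [|r] //=; rewrite add1n ltnS IHs.
have hall : all (fun m => m <= j)%N s.
  have := order_path_min (rev_trans leq_trans) hxs.
  by apply: sub_all => m /= /leq_trans; apply.
have -> : count (fun m => j < m)%N s = 0%N.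
  apply/eqP; rewrite -leqn0 leqNgt -has_count; apply/hasPn => m /(allP hall) /=.
  by rewrite -leqNgt.
rewrite ltn0; case: r => [|r] /=; apply/esym/negbTE; rewrite -leqNgt //.
case: (ltnP r (size s)) => hr; first exact: (allP hall) (mem_nth _ hr).
by rewrite nth_default.
Qed.

Section Partitions.
Variables (n : nat).
Implicit Types (mu nu : intpart n).

Lemma partE mu i : part mu i = nth 0%N [seq val x | x <- mu] i.
Proof.
rewrite /part; case: (ltnP i (size mu)) => hi; first by rewrite (nth_map ord0).
by rewrite !nth_default ?size_map.
Qed.

Lemma intpartP mu : is_intpart mu.
Proof. exact: valP. Qed.

(** Both sides say that (r, j) is a cell of the Young diagram of [mu]. *)
Lemma ltn_part mu (j r : nat) : (j < part mu r)%N = (r < conj_part mu j)%N.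
Proof.
have /andP[hs _] := intpartP mu.
rewrite partE -ltn_count_sorted // /conj_part /parts !count_map count_filter.
congr (_ < _)%N; apply: eq_count => x /=.
by case: (ltnP j x) => //= /(leq_ltn_trans (leq0n j)) ->.
Qed.

Lemma part_gt mu i : (n <= i)%N -> part mu i = 0%N.
Proof. by move=> hi; rewrite partE nth_default // size_map size_tuple. Qed.

Lemma part_le mu i : (part mu i <= n)%N.
Proof. by rewrite /part -ltnS. Qed.

Lemma conj_part_le mu j : (conj_part mu j <= n)%N.
Proof. by rewrite leqNgt -ltn_part part_gt. Qed.

Lemma conj_part_gt mu j : (n <= j)%N -> conj_part mu j = 0%N.
Proof.
move=> hj; apply/eqP; rewrite -leqn0 leqNgt -ltn_part -leqNgt.
exact: leq_trans (part_le _ _) hj.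
Qed.

Lemma conj_part_inj mu nu :
  (forall j : 'I_n, conj_part mu j = conj_part nu j) -> mu = nu.
Proof.
move=> h; have h' j : conj_part mu j = conj_part nu j.
  case: (ltnP j n) => hj; first exact: (h (Ordinal hj)).
  by rewrite !conj_part_gt.
apply/val_inj/val_inj/(@eq_from_nth _ ord0) => /=; first by rewrite !size_tuple.
move=> i _; apply/val_inj; change (part mu i = part nu i).
have H j : (j < part mu i)%N = (j < part nu i)%N by rewrite !ltn_part h'.
case: (ltngtP (part mu i) (part nu i)) => //; first by rewrite -H ltnn.
by rewrite H ltnn.
Qed.

Lemma sum_ltn_minn (a k : nat) : (\sum_(l < k) (l < a))%N = minn a k.
Proof.
elim: k => [|k IHk]; first by rewrite big_ord0 minn0.
by rewrite big_ord_recr /= IHk; lia.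
Qed.

Lemma conj_partE mu (j : nat) :
  conj_part mu j = (\sum_(r < n) (j < part mu r))%N.
Proof.
under eq_bigr do rewrite ltn_part.
by rewrite sum_ltn_minn; apply/esym/minn_idPl/conj_part_le.
Qed.

(** The cells of the first [k] columns, counted by rows. *)
Lemma sum_conj_part mu k :
  (\sum_(l < k) conj_part mu l = \sum_(r < n) minn (part mu r) k)%N.
Proof.
under eq_bigr do rewrite conj_partE.
rewrite exchange_big /=; apply: eq_bigr => r _; exact: sum_ltn_minn.
Qed.

Lemma sum_part mu : (\sum_(r < n) part mu r)%N = n.
Proof.
have /andP[_ /eqP h] := intpartP mu; rewrite -[RHS]h (big_nth ord0) size_tuple.
by rewrite big_mkord.
Qed.

End Partitions.

(** * Coefficients of monomials *)

Section Contents.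
Variable n : nat.
Implicit Types (kappa : {ffun 'I_n -> 'I_n}) (z : {ffun 'I_n -> {set 'I_n}}).

Definition content kappa : 'X_{1..n} := (\sum_(x < n) U_(kappa x))%MM.

Definition mxcontent z : 'X_{1..n} := (\sum_(r < n) mesym1 (z r))%MM.

Definition row_sums z (mu : intpart n) : bool :=
  [forall r : 'I_n, #|z r| == part mu r].

Lemma contentE kappa l : content kappa l = #|[set x | kappa x == l]|.
Proof.
rewrite /content mnm_sumE -sum1dep_card [RHS]big_mkcond /=.
by apply: eq_bigr => x _; rewrite mnm1E; case: eqP.
Qed.

Lemma mxcontentE z l : mxcontent z l = #|[set r | l \in z r]|.
Proof.
rewrite /mxcontent mnm_sumE -sum1dep_card [RHS]big_mkcond /=.
by apply: eq_bigr => r _; rewrite mnmE; case: (l \in z r).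
Qed.

Lemma coef_chromatic (G : rel 'I_n) (nu : 'X_{1..n}) :
  (chromatic_qsym G n)@_nu =
    \sum_(kappa | proper_coloring G kappa && (content kappa == nu))
       'X^(inv_coloring G kappa).
Proof.
rewrite /chromatic_qsym raddf_sum /= big_mkcondr /=; apply: eq_bigr => kappa _.
rewrite mcoeffZ mprodXE mcoeffX -/(content kappa).
by case: eqP; rewrite ?mulr1 ?mulr0.
Qed.

(** As e_0 = 1, the zero parts may be kept in a product of elementary symmetric
    polynomials, so every partition of [n] gets a matrix with exactly [n] rows. *)
Lemma prod_parts (R : comNzRingType) (mu : intpart n) (F : nat -> R) :
  F 0%N = 1 -> \prod_(m <- parts mu) F m = \prod_(r < n) F (part mu r).
Proof.
move=> hF; rewrite /parts big_map big_filter big_mkcond /=.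
rewrite (big_nth ord0) size_tuple big_mkord; apply: eq_bigr => r _.
by rewrite -/(part mu r) lt0n; case: eqP => //= ->.
Qed.

(** Expanding the product of the e_(mu_r) amounts to choosing a set of columns in
    each row [r], that is, a 0-1 matrix, stored as the family [z] of its rows. *)
Lemma coef_elementary (R : comNzRingType) (mu : intpart n) (nu : 'X_{1..n}) :
  (elementary R mu n)@_nu =
    (#|[set z | row_sums z mu && (mxcontent z == nu)]|%:R : R).
Proof.
rewrite /elementary prod_parts ?mesym0E //.
under eq_bigr do rewrite mesymE.
rewrite bigA_distr_big_dep /= raddf_sum /= -sum1dep_card natr_sum [RHS]big_mkcondr /=.
apply: eq_big => z; first by apply/familyP/forallP.
by move=> _; rewrite mprodXE mcoeffX /mxcontent; case: eqP.
Qed.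

Lemma e_coefficients_contents (G : rel 'I_n) (c : intpart n -> {poly int})
    (nu : 'X_{1..n}) :
  e_coefficients (chromatic_qsym G) c ->
  \sum_(kappa | proper_coloring G kappa && (content kappa == nu))
       'X^(inv_coloring G kappa) =
  \sum_(z | mxcontent z == nu) \sum_(mu | row_sums z mu) c mu.
Proof.
move=> /(_ n) /(congr1 (mcoeff nu)); rewrite coef_chromatic => ->.
rewrite raddf_sum /= (exchange_big_dep xpredT) //=; apply: eq_bigr => mu _.
rewrite mcoeffZ coef_elementary sumr_const mulr_natr; congr (_ *+ _).
by apply: eq_card => z; rewrite !inE unfold_in /= andbC.
Qed.

End Contents.

(** * Flip systems *)

(** What colourings and 0-1 matrices have in common. An object [z] has
    flippable components, elements of [K]: those in [L z] have one unit more of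
    [i] than of [i'], those in [R z] one unit more of [i'], and flipping a
    component exchanges [i] and [i'] on it. *)
Record flip_system (n : nat) (i i' : 'I_n) (Z K : finType) (V : zmodType)
    (good : pred Z) (w : Z -> V) (cont : Z -> 'X_{1..n})
    (L R : Z -> {set K}) (flip : Z -> K -> Z) : Prop := FlipSystem {
  flipR : forall z k, good z -> k \in R z ->
    [/\ good (flip z k), R (flip z k) = R z :\ k & k \in L (flip z k)] /\
    [/\ flip (flip z k) k = z, w (flip z k) = w z &
        cont (flip z k) + U_(i') = cont z + U_(i)]%MM;
  flipL : forall z k, good z -> k \in L z ->
    [/\ good (flip z k), k \notin R z & R (flip z k) = k |: R z] /\
    [/\ flip (flip z k) k = z, w (flip z k) = w z &
        cont (flip z k) + U_(i) = cont z + U_(i')]%MM;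
  card_flip : forall z, good z -> (#|L z| + cont z i' = #|R z| + cont z i)%N;
  card_flipR : forall z, good z -> (#|R z| <= cont z i')%N
}.

Section FlipSystem.
Variables (n : nat) (i i' : 'I_n) (Z K : finType) (V : zmodType).
Variables (good : pred Z) (w : Z -> V) (cont : Z -> 'X_{1..n}).
Variables (L R : Z -> {set K}) (flip : Z -> K -> Z).
Hypothesis fs : flip_system i i' good w cont L R flip.

Definition flip_sum (r : nat) (nu : 'X_{1..n}) : V :=
  \sum_(z | [&& good z, cont z == nu & #|R z| == r]) w z.

(** Both sides count, with weights, the pairs formed of an object and one of its
    components: flipping the component turns a component of [R] in an object of
    content [nu] into a component of [L] in an object of content [nu']. *)
Lemma flip_sum_recursion (r : nat) (nu nu' : 'X_{1..n}) :
  (nu' + U_(i') = nu + U_(i))%MM ->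
  flip_sum r.+1 nu *+ r.+1 = flip_sum r nu' *+ (r + nu' i - nu' i').
Proof.
move=> hnu; pose h (p : Z * K) := (flip p.1 p.2, p.2).
have expand (s : nat) (m : 'X_{1..n}) (A : Z -> {set K}) :
    \sum_(z | [&& good z, cont z == m & #|R z| == s]) w z *+ #|A z| =
    \sum_(p : Z * K | [&& good p.1, cont p.1 == m & #|R p.1| == s]
                        && (p.2 \in A p.1)) w p.1.
  by under eq_bigr do rewrite -sumr_const; rewrite pair_big_dep.
transitivity (\sum_(z | [&& good z, cont z == nu & #|R z| == r.+1])
                 w z *+ #|R z|).
  by rewrite -sumrMnl; apply: eq_bigr => z /and3P[_ _ /eqP->].
transitivity (\sum_(z | [&& good z, cont z == nu' & #|R z| == r])
                 w z *+ #|L z|); last first.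
  rewrite -sumrMnl; apply: eq_bigr => z /and3P[gz /eqP hz /eqP hr].
  have := card_flip fs gz; rewrite hz hr => <-.
  by rewrite addnK.
rewrite !expand (reindex_onto h h) /=; last first.
  case=> z k /= /andP[/and3P[gz _ _] kz].
  by rewrite /h /=; case: (flipR fs gz kz) => _ [-> _ _].
apply: eq_big => [[z k]|[z k]] /=; last first.
  case/andP=> /andP[/and3P[gz _ _] kz] /eqP[hz].
  by move: hz; case: (flipR fs gz kz) => _ [_ <- _] ->.
apply/idP/idP.
  case/andP=> /andP[/and3P[gz /eqP hc /eqP hr] kz] /eqP[hz].
  case: (flipR fs gz kz); rewrite hz => -[-> hR ->] [_ _ hcz].
  move: hcz; rewrite hc -hnu => /eqP; rewrite eqm_add2r => ->; rewrite !andbT /=.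
  by rewrite hR; have := cardsD1 k (R (flip z k)); rewrite kz hr add1n => -[->].
case/andP=> /and3P[gz /eqP hc /eqP hr] kz.
case: (flipL fs gz kz) => -[-> nk hR] [hz _ hcz].
rewrite /h /= hz eqxx andbT hR setU11 cardsU1 nk hr eqxx andbT.
by rewrite -(eqm_add2r U_(i)) hcz hc hnu eqxx.
Qed.

Lemma flip_sum_eq0 (r : nat) (nu : 'X_{1..n}) :
  nu i' = 0%N -> flip_sum r.+1 nu = 0.
Proof.
move=> h0; rewrite /flip_sum big_pred0 // => z; apply/and3P => -[gz /eqP hz hr].
by have := card_flipR fs gz; rewrite hz h0 (eqP hr).
Qed.

Lemma sum_flip_sum (nu : 'X_{1..n}) :
  \sum_(z | good z && (cont z == nu)) w z = \sum_(r < (nu i').+1) flip_sum r nu.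
Proof.
rewrite (partition_big (fun z => inord #|R z| : 'I_(nu i').+1) xpredT) //=.
apply: eq_bigr => r _; apply: eq_bigl => z.
rewrite -andbA; case: (boolP (good z)) => //= gz; case: eqP => //= hz.
have := card_flipR fs gz; rewrite hz -ltnS => hr.
by apply/eqP/eqP => [<-|hrr]; [rewrite inordK | apply/val_inj; rewrite /= inordK].
Qed.

End FlipSystem.

(** The recursion determines the sums over the objects with r > 0 components in
    [R] from those for the content [nu'], in which [i'] occurs once less; the sum
    for r = 0 is what remains of the total. So by induction on [nu i'] two
    systems with the same totals have the same sums for each r. *)
Lemma flip_sum_determined (n : nat) (i i' : 'I_n) (V : zmodType)
    (Z1 K1 Z2 K2 : finType)
    (good1 : pred Z1) (w1 : Z1 -> V) (cont1 : Z1 -> 'X_{1..n})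
    (L1 R1 : Z1 -> {set K1}) (flip1 : Z1 -> K1 -> Z1)
    (good2 : pred Z2) (w2 : Z2 -> V) (cont2 : Z2 -> 'X_{1..n})
    (L2 R2 : Z2 -> {set K2}) (flip2 : Z2 -> K2 -> Z2) :
  i != i' ->
  (forall k : nat, injective (fun x : V => x *+ k.+1)) ->
  flip_system i i' good1 w1 cont1 L1 R1 flip1 ->
  flip_system i i' good2 w2 cont2 L2 R2 flip2 ->
  (forall nu, \sum_(z | good1 z && (cont1 z == nu)) w1 z =
              \sum_(z | good2 z && (cont2 z == nu)) w2 z) ->
  forall nu, \sum_(z | (good1 z && (R1 z == set0)) && (cont1 z == nu)) w1 z =
             \sum_(z | (good2 z && (R2 z == set0)) && (cont2 z == nu)) w2 z.
Proof.
move=> nii tf fs1 fs2 htot nu.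
suff H b : forall nu : 'X_{1..n}, nu i' = b -> forall r,
    flip_sum good1 w1 cont1 R1 r nu = flip_sum good2 w2 cont2 R2 r nu.
  have := H _ nu erefl 0%N; rewrite /flip_sum => H0; etransitivity; last first.
    etransitivity; first exact: H0.
    by apply: eq_bigl => z; rewrite cards_eq0 [_ && (R2 z == _)]andbC andbA andbAC.
  by apply: eq_bigl => z; rewrite cards_eq0 -andbA [(_ == set0) && _]andbC.
elim: b => [|b IHb] {}nu hb.
  suff H r : flip_sum good1 w1 cont1 R1 r.+1 nu = flip_sum good2 w2 cont2 R2 r.+1 nu.
    case=> [|r]; last exact: H.
    have := htot nu; rewrite (sum_flip_sum fs1) (sum_flip_sum fs2) hb.
    by rewrite !big_ord1.
  by rewrite (flip_sum_eq0 fs1) // (flip_sum_eq0 fs2).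
pose nu' := (nu + U_(i) - U_(i'))%MM.
have hnu : (nu' + U_(i') = nu + U_(i))%MM.
  rewrite /nu' submK //; apply/mnm_lepP => l; rewrite mnmDE !mnm1E.
  by case: eqP => // <-; rewrite hb.
have hS r : flip_sum good1 w1 cont1 R1 r.+1 nu = flip_sum good2 w2 cont2 R2 r.+1 nu.
  apply: (tf r); rewrite /= (flip_sum_recursion fs1 r hnu).
  rewrite (flip_sum_recursion fs2 r hnu) IHb //.
  move/mnmP: hnu => /(_ i'); rewrite !mnmDE !mnm1E eqxx (negbTE nii) hb; lia.
case=> [|r]; last exact: hS.
have := htot nu; rewrite (sum_flip_sum fs1) (sum_flip_sum fs2).
rewrite !big_ord_recl /=; under eq_bigr do rewrite hS.
exact: addIr.
Qed.

(** * Flipping the rows of a 0-1 matrix *)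

Section MatrixFlips.
Variable n : nat.
Implicit Types (z : {ffun 'I_n -> {set 'I_n}}) (a b l r : 'I_n).

(** The rows that read 10 in the columns [a], [b]; with those of
    [mxexcess b a], they are the flippable components of a matrix. *)
Definition mxexcess a b z : {set 'I_n} := [set r | (a \in z r) && (b \notin z r)].

Definition mxflip a b z r : {ffun 'I_n -> {set 'I_n}} :=
  [ffun x => if x == r then [set l | tperm a b l \in z x] else z x].

Lemma mem_mxflip a b z r x l :
  (l \in mxflip a b z r x) = ((if x == r then tperm a b l else l) \in z x).
Proof. by rewrite ffunE; case: eqP; rewrite ?inE. Qed.

Lemma mxflipK a b z r : mxflip a b (mxflip a b z r) r = z.
Proof.
apply/ffunP => x; apply/setP => l; rewrite !mem_mxflip.
by case: eqP => // _; rewrite tpermK.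
Qed.

Lemma mxflipC a b : mxflip a b =2 mxflip b a.
Proof.
by move=> z r; apply/ffunP => x; apply/setP => l; rewrite !mem_mxflip tpermC.
Qed.

Lemma card_mxflip a b z r x : #|mxflip a b z r x| = #|z x|.
Proof.
rewrite ffunE; case: eqP => // _.
rewrite -[RHS](card_preimset _ (@perm_inj _ (tperm a b))).
by apply: eq_card => l; rewrite !inE.
Qed.

Lemma mxexcess_flip_disjoint a b a' b' z r :
  a' != a -> a' != b -> b' != a -> b' != b ->
  mxexcess a' b' (mxflip a b z r) = mxexcess a' b' z.
Proof.
move=> h1 h2 h3 h4; apply/setP => x; rewrite !inE !mem_mxflip.
by case: eqP => // _; rewrite !tpermD // eq_sym.
Qed.

Lemma mxexcess_flip a b z r : r \in mxexcess a b z ->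
  [/\ mxexcess b a (mxflip a b z r) = r |: mxexcess b a z,
      mxexcess a b (mxflip a b z r) = mxexcess a b z :\ r,
      r \notin mxexcess b a z &
      (mxcontent (mxflip a b z r) + U_(a) = mxcontent z + U_(b))%MM].
Proof.
rewrite inE => /andP[ha hb]; split.
- apply/setP => x; rewrite !inE !mem_mxflip.
  by case: eqP => //= ->; rewrite tpermL tpermR ha hb.
- apply/setP => x; rewrite !inE !mem_mxflip.
  by case: eqP => //= ->; rewrite tpermL tpermR (negbTE hb).
- by rewrite inE (negbTE hb).
apply/mnmP => l; rewrite !mnmDE !mxcontentE !mnm1E.
rewrite (cardsD1 r) (cardsD1 r [set _ | l \in z _]) !inE mem_mxflip eqxx.
have -> : #|[set x | l \in mxflip a b z r x] :\ r| = #|[set x | l \in z x] :\ r|.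
  by apply: eq_card => x; rewrite !inE mem_mxflip; case: eqP.
case: tpermP => [->|->|/eqP hla /eqP hlb].
- have -> : (b == a) = false by apply/eqP => h; move: hb; rewrite h ha.
  by rewrite eqxx ha (negbTE hb); lia.
- have -> : (a == b) = false by apply/eqP => h; move: hb; rewrite -h ha.
  by rewrite eqxx ha (negbTE hb); lia.
by rewrite ![_ == l]eq_sym (negbTE hla) (negbTE hlb).
Qed.

Lemma mxexcess_card a b z :
  (#|mxexcess a b z| + mxcontent z b = #|mxexcess b a z| + mxcontent z a)%N.
Proof.
rewrite !mxcontentE -(cardsID [set r | b \in z r] [set r | a \in z r]).
rewrite -(cardsID [set r | a \in z r] [set r | b \in z r]) setIC.
have hE c d : [set r | c \in z r] :\: [set r | d \in z r] = mxexcess c d z.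
  by apply/setP => r; rewrite !inE andbC.
rewrite !hE addnCA [RHS]addnCA; congr (_ + _)%N; exact: addnC.
Qed.

Lemma mx_flip_system a b (V : zmodType) (good : pred {ffun 'I_n -> {set 'I_n}})
    (w : {ffun 'I_n -> {set 'I_n}} -> V) :
  (forall z r, good z -> good (mxflip a b z r)) ->
  (forall z r, w (mxflip a b z r) = w z) ->
  flip_system a b good w (@mxcontent n) (mxexcess a b) (mxexcess b a) (mxflip a b).
Proof.
move=> hg hw; split.
- move=> z r gz hr; rewrite mxflipK hw; split; split => //; first exact: hg.
  + by rewrite mxflipC; case: (mxexcess_flip hr).
  + by rewrite mxflipC; case: (mxexcess_flip hr) => -> _ _ _; rewrite setU11.
  by rewrite mxflipC; case: (mxexcess_flip hr).
- move=> z r gz hr; rewrite mxflipK hw; split; split => //; first exact: hg.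
  + by case: (mxexcess_flip hr).
  + by case: (mxexcess_flip hr).
  by case: (mxexcess_flip hr).
- by move=> z _; apply: mxexcess_card.
move=> z _; rewrite mxcontentE; apply: subset_leq_card.
by apply/subsetP => r; rewrite !inE => /andP[].
Qed.

Lemma row_sums_mxflip a b z r mu : row_sums (mxflip a b z r) mu = row_sums z mu.
Proof. by apply: eq_forallb => x; rewrite card_mxflip. Qed.

End MatrixFlips.

(** * Rigidity of 0-1 matrices with extremal column sums *)

Section Rigidity.
Variable n : nat.
Implicit Types (z : {ffun 'I_n -> {set 'I_n}}) (mu la : intpart n).

(** The largest column sums, in dominance order, that a matrix with row sums [mu]
    can have. *)
Definition conj_mnm mu : 'X_{1..n} := [multinom conj_part mu l | l < n].

Lemma big_ord_ltn (F : nat -> nat) (k : nat) : (k <= n)%N ->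
  (\sum_(l < k) F l = \sum_(l < n | (l < k)%N) F l)%N.
Proof. by move=> hk; rewrite (big_ord_widen n). Qed.

Lemma card_ltn (k : nat) : (k <= n)%N -> #|[set l : 'I_n | (l < k)%N]| = k.
Proof.
move=> hk; rewrite -sum1dep_card -(big_ord_ltn (fun=> 1%N)) //.
by rewrite sum1_card card_ord.
Qed.

Lemma psum_mxcontent z (k : nat) :
  (\sum_(l < n | (l < k)%N) mxcontent z l =
   \sum_(r < n) #|z r :&: [set l : 'I_n | (l < k)%N]|)%N.
Proof.
under eq_bigr do rewrite mxcontentE -sum1dep_card.
rewrite (exchange_big_dep xpredT) //=; apply: eq_bigr => r _.
by rewrite -sum1_card; apply: eq_bigl => l; rewrite !inE andbC.
Qed.

Lemma card_row_le z mu (k : nat) r : (k <= n)%N -> row_sums z mu ->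
  (#|z r :&: [set l : 'I_n | (l < k)%N]| <= minn (part mu r) k)%N.
Proof.
move=> hk /forallP /(_ r) /eqP <-; rewrite leq_min subset_leq_card ?subsetIl //=.
by rewrite -[X in (_ <= X)%N](card_ltn hk) subset_leq_card ?subsetIr.
Qed.

Lemma psum_mxcontent_le z mu (k : nat) : (k <= n)%N -> row_sums z mu ->
  (\sum_(l < n | (l < k)%N) mxcontent z l <= \sum_(l < k) conj_part mu l)%N.
Proof.
move=> hk hz; rewrite psum_mxcontent sum_conj_part; apply: leq_sum => r _.
exact: card_row_le.
Qed.

(** Row [r] has at most min(mu_r, i+1) ones in the first i+1 columns, and
    the hypothesis forces equality for every [r]. A row reading 01 in the columns
    [i], [i'] falls short: it has a one further right and a zero at [i]. *)
Lemma mxexcess_extremal z mu (i i' : 'I_n) : i' = i.+1 :> nat ->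
  row_sums z mu ->
  (\sum_(l < i.+1) conj_part mu l <= \sum_(l < n | (l < i.+1)%N) mxcontent z l)%N ->
  mxexcess i' i z = set0.
Proof.
move=> hi hz hle; apply/setP => r; rewrite !inE; apply/negP => /andP[h1 h2].
have hk : (i.+1 <= n)%N by [].
move: hle; rewrite leqNgt => /negP; apply.
rewrite psum_mxcontent sum_conj_part (bigD1 r) //= [X in (_ < X)%N](bigD1 r) //=.
rewrite -addSn; apply: leq_add; last by apply: leq_sum => x _; apply: card_row_le.
move/forallP: hz => /(_ r) /eqP <-; rewrite leq_min; apply/andP; split.
  apply/proper_card/properP; split; first exact: subsetIl.
  by exists i' => //; rewrite !inE h1 hi ltnn.
rewrite -[X in (_ < X)%N](card_ltn hk); apply/proper_card/properP.
by split; [apply: subsetIr | exists i; rewrite !inE ?ltnSn // (negbTE h2)].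
Qed.

Definition justified mu : {ffun 'I_n -> {set 'I_n}} :=
  [ffun r : 'I_n => [set l : 'I_n | (l < part mu r)%N]].

Lemma row_sums_justified mu : row_sums (justified mu) mu.
Proof. by apply/forallP => r; rewrite ffunE card_ltn ?part_le. Qed.

Lemma mxcontent_justified mu : mxcontent (justified mu) = conj_mnm mu.
Proof.
apply/mnmP => l; rewrite mxcontentE mnmE.
rewrite -[RHS](@card_ltn (conj_part mu l)) ?conj_part_le //.
by apply: eq_card => r; rewrite !inE ffunE inE ltn_part.
Qed.

Lemma mxexcess_justified mu (i i' : 'I_n) : i' = i.+1 :> nat ->
  mxexcess i' i (justified mu) = set0.
Proof.
by move=> hi; apply/setP => r; rewrite !inE ffunE !inE hi; lia.
Qed.

Lemma eq_justified z mu : row_sums z mu ->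
  (forall i i' : 'I_n, i' = i.+1 :> nat -> mxexcess i' i z = set0) ->
  z = justified mu.
Proof.
move=> hz hex; apply/ffunP => r; apply/setP => l; rewrite ffunE inE.
have down (a b : 'I_n) : (a <= b)%N -> b \in z r -> a \in z r.
  move=> hab; have [d] : exists d, (a + d)%N = b by exists (b - a)%N; lia.
  elim: d b {hab} => [|d IHd] b hd hm.
    by have -> : a = b by apply/val_inj; rewrite /= -hd addn0.
  have hb' : (a + d < n)%N by have := ltn_ord b; rewrite -hd; lia.
  apply: (IHd (Ordinal hb')) => //.
  have /setP /(_ r) := hex (Ordinal hb') b (esym (etrans (esym (addnS _ _)) hd)).
  by rewrite !inE hm /= => /negbFE.
have <- : #|z r| = part mu r by apply/eqP; move/forallP: hz; apply.
apply/idP/idP => hl.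
  rewrite -[X in (X < _)%N]/(l : nat) -[X in (X <= _)%N](@card_ltn l.+1) //.
  by apply/subset_leq_card/subsetP => a; rewrite inE ltnS => /down; apply.
apply: contraLR hl => hl; rewrite -leqNgt.
rewrite -[X in (_ <= X)%N](card_ltn (ltnW (ltn_ord l))).
apply/subset_leq_card/subsetP => a ha; rewrite inE ltnNge.
by apply: contra hl => /down; apply.
Qed.

Lemma psum_conj_mnm mu (k : nat) : (k <= n)%N ->
  (\sum_(l < n | (l < k)%N) conj_mnm mu l = \sum_(l < k) conj_part mu l)%N.
Proof.
move=> hk; rewrite (big_ord_ltn (conj_part mu)) //.
by apply: eq_bigr => l _; rewrite mnmE.
Qed.

Lemma conj_mnm_inj : injective conj_mnm.
Proof.
move=> mu nu h; apply: conj_part_inj => j.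
by move/mnmP: h => /(_ j); rewrite !mnmE.
Qed.

Lemma extremal_justified z mu : row_sums z mu -> mxcontent z = conj_mnm mu ->
  z = justified mu.
Proof.
move=> hz hc; apply: eq_justified => // i i' hi; apply: mxexcess_extremal hi hz _.
by rewrite hc psum_conj_mnm.
Qed.

Variables (V : zmodType) (c : intpart n -> V).

(** The only matrix with row sums [la] and content [conj_mnm la] is [justified la],
    so the sum is [c la] once no other partition contributes. *)
Lemma extract_coefficient (Q : pred {ffun 'I_n -> {set 'I_n}}) la :
  Q (justified la) ->
  (forall z mu, Q z -> mxcontent z = conj_mnm la -> row_sums z mu ->
     mu != la -> c mu = 0) ->
  \sum_(z | Q z && (mxcontent z == conj_mnm la)) \sum_(mu | row_sums z mu) c mu
    = c la.
Proof.
move=> hQ h0; rewrite (bigD1 (justified la)) /=; last first.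
  by rewrite hQ mxcontent_justified eqxx.
rewrite [X in _ + X]big1 ?addr0 => [|z /andP[/andP[Qz /eqP hc] hz]].
  rewrite (bigD1 la) ?row_sums_justified //= big1 ?addr0 // => mu /andP[hmu hne].
  by apply: h0 hQ _ hmu hne; rewrite mxcontent_justified.
apply: big1 => mu hmu; apply: (h0 z) => //; apply: contra hz => /eqP hE.
by apply/eqP/extremal_justified => //; rewrite -hE.
Qed.

Variable lgr : intpart n.
Hypothesis vanish : forall (nu : 'X_{1..n}) (k : nat), (k <= n)%N ->
  (\sum_(l < k) part lgr l < \sum_(l < n | (l < k)%N) nu l)%N ->
  \sum_(z | mxcontent z == nu) \sum_(mu | row_sums z mu) c mu = 0.

(** Induction from the top of the dominance order, measured by [Phi]: if the
    conjugate of [mu] exceeds [lgr], the vanishing sum over the matrices of content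
    [conj_mnm mu] involves [c mu] and only coefficients of partitions whose conjugates
    are strictly more dominant, which vanish by induction. *)
Lemma coefficient_support mu (k : nat) : (k <= n)%N ->
  c mu != 0 -> (\sum_(l < k) conj_part mu l <= \sum_(l < k) part lgr l)%N.
Proof.
(* Strictly increasing for the dominance order on conjugates. *)
pose Phi (mu : intpart n) := (\sum_(k < n.+1) \sum_(l < k) conj_part mu l)%N.
have Phi_le la : (Phi la <= n.+1 * n)%N.
  rewrite -[X in (X * _)%N](card_ord n.+1) -sum_nat_const; apply: leq_sum => j _.
  rewrite sum_conj_part -[X in (_ <= X)%N](sum_part la); apply: leq_sum => r _.
  exact: geq_minl.
move: {2}(n.+1 * n - Phi mu).+1 (ltnSn (n.+1 * n - Phi mu)) => m.
elim: m mu k => // m IHm la k hm hk; apply: contraR; rewrite -ltnNge => hbad.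
rewrite -(@extract_coefficient predT) // => [|z mu _ hc hz hne].
  by apply/eqP; apply: (@vanish _ k) => //; rewrite psum_conj_mnm.
have hdom j : (j <= n)%N ->
    (\sum_(l < j) conj_part la l <= \sum_(l < j) conj_part mu l)%N.
  by move=> hj; rewrite -psum_conj_mnm // -hc psum_mxcontent_le.
apply/eqP; apply: contraNT hne => hne.
have hPhi : (Phi mu <= Phi la)%N.
  rewrite leqNgt; apply/negP => hlt.
  have hm' : (n.+1 * n - Phi mu < m)%N.
    by rewrite -ltnS; apply: leq_trans hm; rewrite ltnS ltn_sub2l // (leq_trans hlt).
  have := IHm mu k hm' hk hne; rewrite leqNgt => /negP; apply.
  exact: leq_trans hbad (hdom k hk).
have heq (j : 'I_n.+1) : (\sum_(l < j) conj_part la l = \sum_(l < j) conj_part mu l)%N.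
  have hs : (Phi la <= Phi mu ?= iff [forall j : 'I_n.+1,
      (\sum_(l < j) conj_part la l == \sum_(l < j) conj_part mu l)%N])%N.
    apply: leqif_sum => i _; apply/leqifP; case: ifP => // /negbT hij.
    by rewrite ltn_neqAle hij hdom // -ltnS.
  apply/eqP; move: j; apply/forallP; by rewrite -(geq_leqif hs).
apply/eqP/esym/conj_part_inj => j.
have := heq (Ordinal (ltn_ord j : (j.+1 < n.+1)%N)).
rewrite !big_ord_recr /= (heq (Ordinal (ltnW (ltn_ord j : (j.+1 < n.+1)%N)))) /=.
exact: addnI.
Qed.

End Rigidity.

(** * Ladders are paths *)

(** The pairs of [P] form a staircase above the diagonal of the n by n square: the
    form in which the unit interval structure enters the arguments below. *)
Definition staircase (n : nat) (P : rel 'I_n) : Prop :=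
  (forall x y : 'I_n, P x y -> (x < y)%N) /\
  (forall x x' y y' : 'I_n, (x' <= x)%N -> (y <= y')%N -> P x y -> P x' y').

Lemma natural_staircase (R : realType) (n : nat) (P : rel 'I_n) :
  natural_unit_interval_order R P -> staircase P.
Proof.
case=> a [ha hP]; split=> [x y /hP hxy|x x' y y' hx hy /hP hxy].
  rewrite ltnNge; apply/negP => /ha hyx.
  have := lt_le_trans hxy hyx; rewrite ltNge => /negP; apply.
  by rewrite lerDl ler01.
by apply/hP; apply: le_lt_trans (lt_le_trans hxy (ha _ _ hy)); rewrite lerD2r ha.
Qed.

Section Ladders.
Variables (n : nat) (P : rel 'I_n).
Hypothesis hP : staircase P.
Implicit Types (x y u v : 'I_n) (A C D L : {set 'I_n}).

Lemma P_lt x y : P x y -> (x < y)%N. Proof. by case: hP => h _; apply: h. Qed.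

Lemma P_mono x x' y y' : (x' <= x)%N -> (y <= y')%N -> P x y -> P x' y'.
Proof. by case: hP => _; apply. Qed.

Lemma incE x y : (x < y)%N -> inc P x y = ~~ P x y.
Proof.
move=> hxy; rewrite /inc -val_eqE /= neq_ltn hxy /=; case: (P x y) => //=.
by apply/negP => /P_lt; rewrite ltnNge (ltnW hxy).
Qed.

Lemma inc_sym x y : inc P x y = inc P y x.
Proof. by rewrite /inc eq_sym [~~ P x y && _]andbC. Qed.

Lemma chain_not_inc C x y : is_chain P C -> x \in C -> y \in C -> ~~ inc P x y.
Proof.
move=> /forall_inP /(_ x) h hx hy; have /forall_inP /(_ y hy) := h hx.
by rewrite /inc; case: eqP => //= _ /orP[->|->]; rewrite ?andbF.
Qed.

Lemma chain_lt C x y : is_chain P C -> x \in C -> y \in C -> (x < y)%N -> P x y.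
Proof. by move=> hC hx hy hxy; apply: negbNE; rewrite -incE // (chain_not_inc hC). Qed.

(** For x < v < v', if [P v v'] then [P x v']. *)
Lemma upper_neighbour_unique D x v v' : is_chain P D -> v \in D -> v' \in D ->
  (x < v)%N -> (x < v')%N -> inc P x v -> inc P x v' -> v = v'.
Proof.
move=> hD; wlog hvv : v v' / (v < v')%N => [hwlog|] hv hv' hx hx' hi hi'.
  by case: (ltngtP v v') => [h|h|/val_inj//]; [| apply: esym]; apply: hwlog.
move: hi'; rewrite incE // => /negP[].
exact: P_mono (ltnW hx) (leqnn _) (chain_lt hD hv hv' hvv).
Qed.

Lemma lower_neighbour_unique C x u u' : is_chain P C -> u \in C -> u' \in C ->
  (u < x)%N -> (u' < x)%N -> inc P u x -> inc P u' x -> u = u'.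
Proof.
move=> hC; wlog huu : u u' / (u < u')%N => [hwlog|] hu hu' hx hx' hi hi'.
  by case: (ltngtP u u') => [h|h|/val_inj//]; [| apply: esym]; apply: hwlog.
move: hi; rewrite incE // => /negP[].
exact: P_mono (leqnn _) (ltnW hx') (chain_lt hC hu hu' huu).
Qed.

Definition edge_in A : rel 'I_n := fun x y => [&& x \in A, y \in A & inc P x y].

Lemma connect_edge_sym A : connect_sym (edge_in A).
Proof. by apply: sym_connect_sym => x y; rewrite /edge_in inc_sym andbCA. Qed.

Lemma ladders_partition C D : partition (ladders P C D) (C :|: D).
Proof.
apply: equivalence_partitionP => x y z _ _ _; split; first exact: connect0.
by move=> h; rewrite (same_connect (connect_edge_sym (C :|: D)) h).
Qed.

Lemma laddersC C D : ladders P C D = ladders P D C.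
Proof. by rewrite /ladders setUC. Qed.

Section OneLadder.
Variables (C D L : {set 'I_n}).
Hypothesis hL : L \in ladders P C D.

Lemma mem_ladder x y : x \in L ->
  (y \in L) = connect (edge_in (C :|: D)) x y && (y \in C :|: D).
Proof.
move: hL => /imsetP[z hz ->]; rewrite !inE => /andP[hx hzx].
by rewrite (same_connect (connect_edge_sym (C :|: D)) hzx) andbC.
Qed.

Lemma ladder_sub : L \subset C :|: D.
Proof.
have /and3P[/eqP <- _ _] := ladders_partition C D; exact: bigcup_sup.
Qed.

Lemma ladder_closed x y : x \in L -> y \in C :|: D -> inc P x y -> y \in L.
Proof.
move=> hx hy hxy; rewrite (mem_ladder y hx) hy andbT connect1 //.
by rewrite /edge_in hy hxy (subsetP ladder_sub).
Qed.

(** A path of the ladder from [x] to [y] has a step from some z <= x to some t > x,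
    and [t] is then incomparable to [x] already. With the uniqueness of upper
    neighbours in a chain, this makes the ladder a path with increasing labels. *)
Lemma ladder_upper x y : x \in L -> y \in L -> (x < y)%N ->
  exists v, [&& v \in L, (x < v)%N & inc P x v].
Proof.
move=> hx hy hxy; apply/existsP; apply: contraLR hxy => /existsPn hno.
rewrite -leqNgt; move: hy; rewrite (mem_ladder y hx) => /andP[/connectP[p hp ->] _].
suff H z : z \in L -> path (edge_in (C :|: D)) z p -> (z <= x)%N -> (last z p <= x)%N.
  exact: H.
elim: p z {hp} => //= t p IHp z hz /andP[/and3P[_ ht hzt] hp] hzx.
have htL := ladder_closed hz ht hzt; apply: IHp => //.
rewrite leqNgt; apply/negP => hxt; have := hno t; rewrite htL hxt /=.
rewrite incE // negbK => /(P_mono hzx (leqnn _)).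
by apply/negP; rewrite -incE // (leq_ltn_trans hzx).
Qed.

Lemma ladder_lower x y : x \in L -> y \in L -> (y < x)%N ->
  exists u, [&& u \in L, (u < x)%N & inc P u x].
Proof.
move=> hx hy hxy; apply/existsP; apply: contraLR hxy => /existsPn hno.
rewrite -leqNgt; move: hy; rewrite (mem_ladder y hx) => /andP[/connectP[p hp ->] _].
suff H z : z \in L -> path (edge_in (C :|: D)) z p -> (x <= z)%N -> (x <= last z p)%N.
  exact: H.
elim: p z {hp} => //= t p IHp z hz /andP[/and3P[_ ht hzt] hp] hzx.
have htL := ladder_closed hz ht hzt; apply: IHp => //.
rewrite leqNgt; apply/negP => hxt; have := hno t; rewrite htL hxt /=.
rewrite incE // negbK => /(P_mono (leqnn _) hzx).
by apply/negP; rewrite -incE 1?inc_sym // (leq_trans hxt).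
Qed.

End OneLadder.

Definition edges L C D : {set 'I_n * 'I_n} :=
  [set p | [&& p.1 \in L :&: C, p.2 \in L :&: D, (p.1 < p.2)%N & inc P p.1 p.2]].

(** Each element of [C] in the ladder except its maximum has exactly one upper
    neighbour, and it lies in [D]. *)
Lemma card_edges_upper C D L m : is_chain P C -> is_chain P D ->
  L \in ladders P C D -> m \in L -> (forall x, x \in L -> x <= m)%N ->
  (#|edges L C D| + (m \in C) = #|L :&: C|)%N.
Proof.
move=> hC hD hL hm hmax.
have -> : #|edges L C D| = #|(L :&: C) :\ m|.
  rewrite -(@card_in_imset _ _ fst (edges L C D)); last first.
    move=> [x y] [x' y']; rewrite !inE /= => /and4P[_ /andP[_ hy] hxy hi].
    move=> /and4P[_ /andP[_ hy'] hxy' hi'] hx; subst x'; congr (_, _).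
    exact: upper_neighbour_unique hD hy hy' hxy hxy' hi hi'.
  apply: eq_card => x; rewrite !inE; apply/imsetP/idP => [[[u v]]|].
    rewrite !inE /= => /and4P[/andP[hu1 hu2] /andP[hv _] huv _] ->.
    rewrite hu1 hu2 /= andbT; apply/eqP => hum.
    by have := hmax _ hv; rewrite leqNgt -hum huv.
  case/and3P=> hxm hx hxC; have hlt : (x < m)%N by rewrite ltn_neqAle hmax // hxm.
  have [v /and3P[hv hxv hi]] := ladder_upper hL hx hm hlt.
  exists (x, v) => //; rewrite !inE /= hx hxC hv hxv hi /= andbT.
  have := subsetP (ladder_sub hL) _ hv; rewrite inE => /orP[hvC|//].
  by have := chain_not_inc hC hxC hvC; rewrite hi.
by rewrite [RHS](cardsD1 m) inE hm addnC.
Qed.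

Lemma card_edges_lower C D L m : is_chain P C -> is_chain P D ->
  L \in ladders P C D -> m \in L -> (forall x, x \in L -> m <= x)%N ->
  (#|edges L C D| + (m \in D) = #|L :&: D|)%N.
Proof.
move=> hC hD hL hm hmin.
have -> : #|edges L C D| = #|(L :&: D) :\ m|.
  rewrite -(@card_in_imset _ _ snd (edges L C D)); last first.
    move=> [x y] [x' y']; rewrite !inE /= => /and4P[/andP[_ hx] _ hxy hi].
    move=> /and4P[/andP[_ hx'] _ hxy' hi'] hy; subst y'; congr (_, _).
    exact: lower_neighbour_unique hC hx hx' hxy hxy' hi hi'.
  apply: eq_card => x; rewrite !inE; apply/imsetP/idP => [[[u v]]|].
    rewrite !inE /= => /and4P[/andP[hu _] /andP[hv1 hv2] huv _] ->.
    rewrite hv1 hv2 /= andbT; apply/eqP => hum.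
    by have := hmin _ hu; rewrite leqNgt -hum huv.
  case/and3P=> hxm hx hxD; have hlt : (m < x)%N by rewrite ltn_neqAle eq_sym hxm hmin.
  have [u /and3P[hu hux hi]] := ladder_lower hL hx hm hlt.
  exists (u, x) => //; rewrite !inE /= hx hxD hu hux hi /= !andbT.
  have := subsetP (ladder_sub hL) _ hu; rewrite inE => /orP[//|huD].
  by have := chain_not_inc hD huD hxD; rewrite hi.
by rewrite [RHS](cardsD1 m) inE hm addnC.
Qed.

Lemma ladder_max C D L : L \in ladders P C D ->
  exists2 m, m \in L & forall x, x \in L -> (x <= m)%N.
Proof.
have /and3P[_ _ h0] := ladders_partition C D.
move=> hL; have /set0Pn[x hx] : L != set0 by apply: contraNneq h0 => <-.
by case: (@arg_maxnP _ x (fun y => y \in L) val hx) => m hm hmax; exists m.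
Qed.

Lemma ladder_min C D L : L \in ladders P C D ->
  exists2 m, m \in L & forall x, x \in L -> (m <= x)%N.
Proof.
have /and3P[_ _ h0] := ladders_partition C D.
move=> hL; have /set0Pn[x hx] : L != set0 by apply: contraNneq h0 => <-.
by case: (@arg_minnP _ x (fun y => y \in L) val hx) => m hm hmax; exists m.
Qed.

(** The elements of a path alternate between [C] and [D]. Counting the edges by
    their lower and by their upper ends gives |L :&: C| - |L :&: D| =
    [max L in C] + [min L in C] - 1; when this is not 0, the number of edges is
    even and the two kinds of edges alternate. *)
Lemma ladder_balance C D L : is_chain P C -> is_chain P D -> [disjoint C & D] ->
  L \in ladders P C D ->
  (#|L :&: C| <= #|L :&: D|.+1)%N /\
  (#|L :&: C| <> #|L :&: D| -> #|edges L C D| = #|edges L D C|).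
Proof.
move=> hC hD hdis hL; have hL' := hL; rewrite laddersC in hL'.
have [M hM hmax] := ladder_max hL; have [m hm hmin] := ladder_min hL.
have h1 := card_edges_upper hC hD hL hM hmax.
have h2 := card_edges_lower hC hD hL hm hmin.
have h3 := card_edges_upper hD hC hL' hM hmax.
have h4 := card_edges_lower hD hC hL' hm hmin.
have hx x : x \in L -> ((x \in C) + (x \in D) = 1)%N.
  move=> /(subsetP (ladder_sub hL)); rewrite inE.
  case: (boolP (x \in C)) => hxC; last by move=> /= ->.
  by rewrite (disjointFr hdis hxC).
(* The maximum and the minimum each lie in exactly one of C and D. *)
have := hx _ hM; have := hx _ hm; lia.
Qed.

(** In a ladder whose maximum is in [C], match each element of [D] with its upper
    neighbour; in any other ladder the minimum is then in [C], and lower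
    neighbours do. *)
Lemma matching_of_balanced C D : is_chain P C -> is_chain P D -> [disjoint C & D] ->
  (forall L, L \in ladders P C D -> (#|L :&: D| <= #|L :&: C|)%N) ->
  exists f : 'I_n -> 'I_n, {in D &, injective f} /\
    {in D, forall y, f y \in C /\ inc P y (f y)}.
Proof.
move=> hC hD hdis hbal; have hpart := ladders_partition C D.
have /and3P[/eqP hcov htriv _] := hpart.
pose block y := pblock (ladders P C D) y.
pose top L := [exists m in L, (m \in C) && [forall x in L, (x <= m)%N]].
pose rel_match y v := [&& v \in C, inc P y v, v \in block y &
  if top (block y) then (y < v)%N else (v < y)%N].
have hblock y : y \in D -> y \in block y /\ block y \in ladders P C D.
  move=> hy; rewrite /block mem_pblock pblock_mem hcov inE hy orbT //.
have hex y : y \in D -> exists v, rel_match y v.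
  move=> hy; have [hyL hL] := hblock y hy; rewrite /rel_match.
  move: (block y) hyL hL => L hyL hL; case htop: (top L).
    move/existsP: htop => [m /and3P[hm hmC /forall_inP hmax]].
    have hym : (y < m)%N.
      rewrite ltn_neqAle hmax // andbT; apply/eqP => /val_inj hE.
      by move: hy; rewrite hE (disjointFr hdis).
    have [v /and3P[hv hyv hi]] := ladder_upper hL hyL hm hym.
    exists v; rewrite hv hyv hi !andbT.
    have := subsetP (ladder_sub hL) _ hv; rewrite inE => /orP[//|hvD].
    by have := chain_not_inc hD hy hvD; rewrite hi.
  have [M hM hmax] := ladder_max hL; have [m hm hmin] := ladder_min hL.
  have hMC : (M \in C) = false.
    apply/negP => hMC; move/negbT/negP: htop; apply; apply/existsP; exists M.
    by rewrite hM hMC; apply/forall_inP.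
  have := card_edges_upper hC hD hL hM hmax; rewrite hMC addn0 => hE.
  have := card_edges_lower hC hD hL hm hmin; rewrite hE => hE'.
  have hmD : (m \in D) = false.
    by have := hbal L hL; rewrite -hE'; case: (m \in D) => //; rewrite addn1 ltnn.
  have hym : (m < y)%N.
    rewrite ltn_neqAle hmin // andbT; apply/eqP => /val_inj hE1.
    by move: hmD; rewrite hE1 hy.
  have [v /and3P[hv hyv hi]] := ladder_lower hL hyL hm hym.
  exists v; rewrite hv hyv inc_sym hi !andbT.
  have := subsetP (ladder_sub hL) _ hv; rewrite inE => /orP[//|hvD].
  by have := chain_not_inc hD hvD hy; rewrite hi.
pose f y := odflt y [pick v | rel_match y v].
have hf y : y \in D -> rel_match y (f y).
  by move=> /hex[v hv]; rewrite /f; case: pickP => // /(_ v); rewrite hv.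
exists f; split; last by move=> y /hf /and4P[].
move=> y y' hy hy' hE; have := hf y' hy'; have := hf y hy; rewrite -hE.
move: (f y) => v /and4P[hvC hi hv hlt] /and4P[_ hi' hv' hlt'].
have [_ hL] := hblock y hy; have [_ hL'] := hblock y' hy'.
have hbb : block y = block y'.
  by rewrite -(def_pblock htriv hL hv) -(def_pblock htriv hL' hv').
move: hlt hlt'; rewrite hbb; case: ifP => _ h1 h2.
  exact: lower_neighbour_unique hD hy hy' h1 h2 hi hi'.
rewrite inc_sym in hi; rewrite inc_sym in hi'.
exact: upper_neighbour_unique hD hy hy' h1 h2 hi hi'.
Qed.

End Ladders.

(** * Flipping the ladders of a colouring *)

Section ColouringFlips.
Variables (n : nat) (P : rel 'I_n).
Hypothesis hP : staircase P.
Implicit Types (kappa : {ffun 'I_n -> 'I_n}) (a b : 'I_n) (L M : {set 'I_n}).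

Definition cls kappa a : {set 'I_n} := [set x | kappa x == a].

(** For b = a.+1, [excess b a kappa] is the set of right-unbalanced ladders of the
    colour classes of [a] and [b]. *)
Definition excess a b kappa : {set {set 'I_n}} :=
  [set L in ladders P (cls kappa a) (cls kappa b) |
     (#|L :&: cls kappa b| < #|L :&: cls kappa a|)%N].

Definition cflip a b kappa L : {ffun 'I_n -> 'I_n} :=
  [ffun x => if x \in L then tperm a b (kappa x) else kappa x].

Lemma proper_neq kappa x y :
  proper_coloring (inc P) kappa -> inc P x y -> kappa x != kappa y.
Proof. by move=> /forallP /(_ x) /forallP /(_ y) /implyP; apply. Qed.

Lemma cls_chain kappa a : proper_coloring (inc P) kappa -> is_chain P (cls kappa a).
Proof.
move=> hk; apply/forall_inP => x hx; apply/forall_inP => y hy; apply/implyP => hxy.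
apply/negPn/negP; rewrite negb_or => /andP[h1 h2].
have := proper_neq hk (_ : inc P x y); rewrite /inc hxy h1 h2 => /(_ isT).
by move: hx hy; rewrite !inE => /eqP-> /eqP->; rewrite eqxx.
Qed.

Lemma cls_disjoint kappa a b : a != b -> [disjoint cls kappa a & cls kappa b].
Proof.
move=> hab; rewrite disjoint_subset; apply/subsetP => x; rewrite !inE => /eqP->.
by [].
Qed.

Lemma content_cls kappa a : content kappa a = #|cls kappa a|.
Proof. exact: contentE. Qed.

Lemma cflipK a b kappa L : cflip a b (cflip a b kappa L) L = kappa.
Proof. by apply/ffunP => x; rewrite !ffunE; case: (x \in L); rewrite ?tpermK. Qed.

Lemma cflipC a b : cflip a b =2 cflip b a.
Proof. by move=> kappa L; apply/ffunP => x; rewrite !ffunE tpermC. Qed.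

Lemma cls_cflip_disjoint a b c kappa L :
  c != a -> c != b -> cls (cflip a b kappa L) c = cls kappa c.
Proof.
move=> ha hb; apply/setP => x; rewrite !inE ffunE; case: ifP => // _.
by rewrite -{1}[c](@tpermD _ a b) 1?eq_sym // (inj_eq perm_inj).
Qed.

Lemma excess_flip_disjoint a b a' b' kappa L :
  a' != a -> a' != b -> b' != a -> b' != b ->
  excess a' b' (cflip a b kappa L) = excess a' b' kappa.
Proof. by move=> h1 h2 h3 h4; rewrite /excess !cls_cflip_disjoint. Qed.

Lemma mem_cls_cflipL a b kappa L x : x \in L ->
  (x \in cls (cflip a b kappa L) a) = (x \in cls kappa b).
Proof.
by move=> hx; rewrite !inE ffunE hx -{2}(tpermR a b) (inj_eq perm_inj).
Qed.

Lemma mem_cls_cflipR a b kappa L x : x \in L ->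
  (x \in cls (cflip a b kappa L) b) = (x \in cls kappa a).
Proof. by rewrite cflipC; apply: mem_cls_cflipL. Qed.

Lemma mem_cls_cflipN a b c kappa L x : x \notin L ->
  (x \in cls (cflip a b kappa L) c) = (x \in cls kappa c).
Proof. by move=> /negbTE hx; rewrite !inE ffunE hx. Qed.

Lemma cls_cflipU a b kappa L :
  cls (cflip a b kappa L) a :|: cls (cflip a b kappa L) b =
  cls kappa a :|: cls kappa b.
Proof.
apply/setP => x; rewrite 2!in_setU; have [hx|hx] := boolP (x \in L).
  by rewrite mem_cls_cflipL // mem_cls_cflipR // orbC.
by rewrite !mem_cls_cflipN.
Qed.

Lemma ladders_cflip a b kappa L :
  ladders P (cls (cflip a b kappa L) a) (cls (cflip a b kappa L) b) =
  ladders P (cls kappa a) (cls kappa b).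
Proof. by rewrite /ladders cls_cflipU. Qed.

Lemma setI_cls_cflip a b kappa L :
  (L :&: cls (cflip a b kappa L) a = L :&: cls kappa b) *
  (L :&: cls (cflip a b kappa L) b = L :&: cls kappa a).
Proof.
by split; apply/setP => x; rewrite !in_setI;
   case: (boolP (x \in L)) => hx //; rewrite ?mem_cls_cflipL ?mem_cls_cflipR.
Qed.

Lemma setI_cls_cflipN a b c kappa L M : [disjoint M & L] ->
  M :&: cls (cflip a b kappa L) c = M :&: cls kappa c.
Proof.
move=> hd; apply/setP => x; rewrite !in_setI; case: (boolP (x \in M)) => // hx.
by rewrite mem_cls_cflipN // (disjointFr hd hx).
Qed.

Lemma ladders_disjoint C D L M : L \in ladders P C D -> M \in ladders P C D ->
  M != L -> [disjoint M & L].
Proof.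
have /and3P[_ /trivIsetP htriv _] := ladders_partition P C D.
by move=> hL hM; apply: htriv.
Qed.

Lemma proper_cflip a b kappa L : L \in ladders P (cls kappa a) (cls kappa b) ->
  proper_coloring (inc P) kappa -> proper_coloring (inc P) (cflip a b kappa L).
Proof.
move=> hL hk.
have mixed x y : x \in L -> y \notin L -> inc P x y -> tperm a b (kappa x) != kappa y.
  move=> hx hy hxy; apply: contraNneq hy => hE.
  apply: (ladder_closed hL hx _ hxy).
  have := subsetP (ladder_sub hL) _ hx; rewrite !inE -hE.
  by case/orP => /eqP->; rewrite ?tpermL ?tpermR eqxx ?orbT.
apply/forallP => x; apply/forallP => y; apply/implyP => hxy; rewrite !ffunE.
case: ifP => hx; case: ifP => hy.
- by rewrite (inj_eq perm_inj) proper_neq.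
- by apply: mixed => //; rewrite hy.
- by rewrite eq_sym; apply: mixed; rewrite ?hx // inc_sym.
by rewrite proper_neq.
Qed.

Lemma excess_cflip a b kappa L : L \in excess a b kappa ->
  [/\ excess b a (cflip a b kappa L) = L |: excess b a kappa,
      excess a b (cflip a b kappa L) = excess a b kappa :\ L &
      L \notin excess b a kappa].
Proof.
rewrite inE => /andP[hL hlt]; split.
- apply/setP => M; rewrite !inE laddersC ladders_cflip.
  rewrite [ladders P (cls kappa b) _]laddersC.
  case: eqP => [->|/eqP hne] /=; first by rewrite hL !setI_cls_cflip hlt.
  case: (boolP (M \in _)) => //= hM.
  by rewrite !setI_cls_cflipN ?(ladders_disjoint hL).
- apply/setP => M; rewrite !inE ladders_cflip.
  case: eqP => [->|/eqP hne] /=.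
    by rewrite !setI_cls_cflip ltnNge (ltnW hlt) andbF.
  case: (boolP (M \in _)) => //= hM.
  by rewrite !setI_cls_cflipN ?(ladders_disjoint hL).
by rewrite inE negb_and -leqNgt (ltnW hlt) orbT.
Qed.

Lemma sum_ladders (C D A : {set 'I_n}) : A \subset C :|: D ->
  #|A| = (\sum_(L in ladders P C D) #|L :&: A|)%N.
Proof.
move=> hA.
transitivity (\sum_(x in C :|: D) (x \in A : nat))%N.
  rewrite -sum1_card [LHS]big_mkcond [RHS]big_mkcond; apply: eq_bigr => x _.
  by case: (boolP (x \in A)) => [/(subsetP hA) -> //|_]; case: ifP.
rewrite (set_partition_big _ (ladders_partition P C D)); apply: eq_bigr => L _.
rewrite -sum1_card [RHS]big_mkcond [LHS]big_mkcond; apply: eq_bigr => x _.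
by rewrite inE; case: (x \in L).
Qed.

Lemma excess_card a b kappa : a != b -> proper_coloring (inc P) kappa ->
  (#|excess a b kappa| + content kappa b = #|excess b a kappa| + content kappa a)%N.
Proof.
move=> hab hk; rewrite !content_cls.
rewrite (@sum_ladders (cls kappa a) (cls kappa b) (cls kappa a)) ?subsetUl //.
rewrite (@sum_ladders (cls kappa a) (cls kappa b) (cls kappa b)) ?subsetUr //.
have hE c d :
  ladders P (cls kappa c) (cls kappa d) = ladders P (cls kappa a) (cls kappa b) ->
  #|excess c d kappa| = (\sum_(L in ladders P (cls kappa a) (cls kappa b))
     (#|L :&: cls kappa d| < #|L :&: cls kappa c|))%N.
  move=> h; rewrite -sum1dep_card big_mkcondr h; apply: eq_bigr => L _; by case: ifP.
rewrite (hE a b) // (hE b a) ?(laddersC P (cls kappa b)) //.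
rewrite -!big_split; apply: eq_bigr => L hL /=.
have hCa := cls_chain a hk; have hCb := cls_chain b hk.
have [h1 _] := ladder_balance hP hCa hCb (cls_disjoint kappa hab) hL.
rewrite laddersC in hL; rewrite eq_sym in hab.
have [h2 _] := ladder_balance hP hCb hCa (cls_disjoint kappa hab) hL.
move: h1 h2; move: #|_ :&: cls kappa a| #|_ :&: cls kappa b| => x y; lia.
Qed.

Lemma excess_le a b kappa : (#|excess a b kappa| <= content kappa a)%N.
Proof.
rewrite content_cls.
rewrite (@sum_ladders (cls kappa a) (cls kappa b) (cls kappa a)) ?subsetUl //.
rewrite -sum1dep_card big_mkcondr; apply: leq_sum => L _.
by case: ifP => // /(leq_ltn_trans (leq0n _)).
Qed.

Lemma content_cflip a b kappa L : a != b -> proper_coloring (inc P) kappa ->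
  L \in excess a b kappa ->
  (content (cflip a b kappa L) + U_(a) = content kappa + U_(b))%MM.
Proof.
move=> hab hk; rewrite inE => /andP[hL hlt].
have [hle _] := ladder_balance hP (cls_chain a hk) (cls_chain b hk)
  (cls_disjoint kappa hab) hL.
have hE : #|L :&: cls kappa a| = #|L :&: cls kappa b|.+1.
  by apply/eqP; rewrite eqn_leq hle hlt.
have hN c : cls (cflip a b kappa L) c :\: L = cls kappa c :\: L.
  apply/setP => x; rewrite !in_setD.
  by case: (boolP (x \in L)) => //= /mem_cls_cflipN ->.
apply/mnmP => c; rewrite !mnmDE !content_cls !mnm1E.
have [->|hca] := eqVneq c a.
  rewrite [b == a]eq_sym (negbTE hab).
  rewrite -(cardsID L) -[in RHS](cardsID L (cls kappa a)) hN.
  by rewrite ![_ :&: L]setIC !setI_cls_cflip hE; lia.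
have [->|hcb] := eqVneq c b.
  rewrite -(cardsID L) -[in RHS](cardsID L (cls kappa b)) hN.
  by rewrite ![_ :&: L]setIC !setI_cls_cflip hE; lia.
by rewrite cls_cflip_disjoint.
Qed.

(** As [a] and [b] are consecutive, comparisons with other colours are unaffected.
    On the unbalanced ladder [L], the inversions are the edges from the class of
    [b] up to that of [a]; the flip exchanges them with the other edges, which are
    equally many. *)
Lemma inv_cflip a b kappa L : b = a.+1 :> nat -> proper_coloring (inc P) kappa ->
  L \in ladders P (cls kappa a) (cls kappa b) ->
  #|L :&: cls kappa a| <> #|L :&: cls kappa b| ->
  inv_coloring (inc P) (cflip a b kappa L) = inv_coloring (inc P) kappa.
Proof.
move=> hab hk hL hne.
have hab' : a != b by rewrite -val_eqE /= hab neq_ltn ltnSn.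
have [_ /(_ hne) hedge] := ladder_balance hP (cls_chain a hk) (cls_chain b hk)
  (cls_disjoint kappa hab') hL.
(* Only the pairs inside L change status under the flip. *)
pose inner : {set 'I_n * 'I_n} := [set p | (p.1 \in L) && (p.2 \in L)].
rewrite /inv_coloring -(cardsID inner) -[RHS](cardsID inner).
congr (_ + _)%N.
  have hin kap :
    L \in ladders P (cls kap a) (cls kap b) -> proper_coloring (inc P) kap ->
    [set p : 'I_n * 'I_n | [&& (p.1 < p.2)%N, inc P p.1 p.2 & (kap p.2 < kap p.1)%N]]
      :&: inner = edges P L (cls kap b) (cls kap a).
    move=> hLk hkk; apply/setP => -[x y]; rewrite !inE /=.
    have [hx|hx] := boolP (x \in L); last by rewrite !andbF.
    have [hy|hy] := boolP (y \in L); last by rewrite !andbF.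
    rewrite !andbT /=.
    have := subsetP (ladder_sub hLk) _ hx; have := subsetP (ladder_sub hLk) _ hy.
    rewrite !inE; case: (ltnP x y) => hxy /=; rewrite ?andbF //.
    case: (boolP (inc P x y)) => hi; rewrite ?andbF //= !andbT.
    have hne' := proper_neq hkk hi.
    case/orP=> /eqP hky; case/orP=> /eqP hkx; rewrite hkx hky ?eqxx in hne' * => //.
      by rewrite hab ltnSn.
    by rewrite [b == a]eq_sym (negbTE hab') hab ltnNge leqnSn.
  rewrite hin ?ladders_cflip ?proper_cflip // hin //.
  by rewrite /edges !setI_cls_cflip.
apply: eq_card => -[x y]; rewrite !inE /=.
case: (boolP ((x \in L) && (y \in L))) => //= hxy.
case: (ltnP x y) => //= hlt; case: (boolP (inc P x y)) => //= hi.
rewrite !ffunE.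
have mixed u v : u \in L -> v \notin L -> inc P u v ->
    ((tperm a b (kappa u) < kappa v) = (kappa u < kappa v))%N /\
    ((kappa v < tperm a b (kappa u)) = (kappa v < kappa u))%N.
  move=> hu hv huv.
  have hvD : v \notin cls kappa a :|: cls kappa b.
    by apply: contra hv => hv; apply: (ladder_closed hL hu hv huv).
  have := subsetP (ladder_sub hL) _ hu; move: hvD; rewrite !inE -!val_eqE /= negb_or.
  case/andP => h1 h2 /orP[] /eqP/val_inj ->; rewrite ?tpermL ?tpermR; lia.
case: ifP => hy; case: ifP => hx //.
- by rewrite hx hy in hxy.
- by case: (mixed y x) => //; rewrite ?hx // inc_sym.
by case: (mixed x y) => //; rewrite ?hy.
Qed.

Lemma colouring_flip_system a b (good : pred {ffun 'I_n -> 'I_n}) :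
  b = a.+1 :> nat ->
  (forall kappa, good kappa -> proper_coloring (inc P) kappa) ->
  (forall kappa L, L \in ladders P (cls kappa a) (cls kappa b) ->
     good kappa -> good (cflip a b kappa L)) ->
  flip_system a b good (fun kappa => 'X^(inv_coloring (inc P) kappa) : {poly int})
    (@content n) (excess a b) (excess b a) (cflip a b).
Proof.
move=> hab hgp hgf.
have hab' : a != b by rewrite -val_eqE /= hab neq_ltn ltnSn.
split.
- move=> kappa L gk hL; have := hL; rewrite inE => /andP[hL1 hlt].
  have hL2 := hL1; rewrite laddersC in hL2.
  rewrite cflipK inv_cflip ?hgp //; last by move=> h; rewrite h ltnn in hlt.
  have [h1 h2 h3] := excess_cflip hL; rewrite hgf // cflipC h1 h2 setU11.
  by split; split => //; apply: content_cflip hL; rewrite ?hgp // eq_sym.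
- move=> kappa L gk hL; have := hL; rewrite inE => /andP[hL1 hlt].
  rewrite cflipK inv_cflip ?hgp //; last by move=> h; rewrite h ltnn in hlt.
  have [h1 h2 h3] := excess_cflip hL; rewrite hgf // h1.
  by split; split => //; apply: content_cflip hL; rewrite ?hgp.
- by move=> kappa gk; apply: excess_card; rewrite ?hgp.
by move=> kappa _; apply: excess_le.
Qed.

End ColouringFlips.

(** * Standard strong tableaux as colourings *)

Section StrongTableaux.
Variables (n : nat) (P : rel 'I_n) (la : intpart n).
Hypothesis hP : staircase P.
Implicit Types (kappa : {ffun 'I_n -> 'I_n}) (T : filling la) (c d : cell la).

(** The colourings whose classes are the columns of a strong standard tableau of
    shape [la]. *)
Definition strong_colouring kappa : bool :=
  [&& proper_coloring (inc P) kappa, content kappa == conj_mnm la &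
      [forall i : 'I_n, forall i' : 'I_n,
         (i' == i.+1 :> nat) ==> (excess P i' i kappa == set0)]].

Definition column_colouring T : {ffun 'I_n -> 'I_n} :=
  [ffun x => if [pick c | T c == x] is Some c then (val c).2 else x].

Definition cls_rank kappa (x : 'I_n) : nat :=
  #|[set y | (kappa y == kappa x) && (y < x)%N]|.

(** Columns are chains, hence sorted by label, so the row of an entry is the
    number of smaller labels of the same colour. *)
Definition sorted_filling kappa : filling la :=
  [ffun c : cell la => odflt (val c).1
     [pick x | (kappa x == (val c).2) && (cls_rank kappa x == row_of c)]].

Lemma cell_eq c d : row_of c = row_of d -> col_of c = col_of d -> c = d.
Proof.
move=> hr hc; apply/val_inj; move: hr hc; rewrite /row_of /col_of.
by case: (val c) (val d) => [a b] [a' b'] /= /val_inj-> /val_inj->.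
Qed.

Lemma cell_exists (r j : nat) : (r < conj_part la j)%N ->
  exists c : cell la, row_of c = r /\ col_of c = j.
Proof.
move=> hr; have hrn : (r < n)%N := leq_trans hr (conj_part_le la j).
have hj : (j < part la r)%N by rewrite ltn_part.
have hjn : (j < n)%N := leq_trans hj (part_le la r).
by exists (Sub (Ordinal hrn, Ordinal hjn) hj); rewrite /row_of /col_of SubK.
Qed.

Lemma row_lt_conj c : (row_of c < conj_part la (col_of c))%N.
Proof. by rewrite -ltn_part; exact: (valP c). Qed.

Lemma row_lt c : (row_of c < n)%N. Proof. exact: ltn_ord. Qed.

Lemma card_cells (j r : nat) :
  #|[set c : cell la | (col_of c == j) && (row_of c < r)%N]| = minn r (conj_part la j).
Proof.
rewrite -(@card_in_imset _ _ (fun c => (val c).1)); last first.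
  move=> c d; rewrite !inE => /andP[/eqP hc _] /andP[/eqP hd _] hr.
  by apply: cell_eq; rewrite ?hc ?hd // /row_of hr.
rewrite -[RHS](@card_ltn n) ?(leq_trans (geq_minr _ _)) ?conj_part_le //.
apply: eq_card => x; rewrite inE; apply/imsetP/idP.
  case=> c; rewrite inE => /andP[/eqP hc hr] ->; rewrite leq_min hr -hc.
  exact: row_lt_conj.
rewrite leq_min => /andP[hr /cell_exists[c [h1 h2]]]; exists c.
  by rewrite inE h1 h2 eqxx.
exact/val_inj/esym.
Qed.

Section FromTableau.
Variable T : filling la.
Hypothesis hT : is_standard T.

Lemma standard_inj : injective T.
Proof.
move=> c d h; move/forallP: hT => /(_ (T d)) /cards1P[e he].
have : c \in [set c | T c == T d] by rewrite inE h.
have : d \in [set c | T c == T d] by rewrite inE.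
by rewrite he !inE => /eqP-> /eqP->.
Qed.

Lemma standard_surj x : exists c, T c = x.
Proof.
move/forallP: hT => /(_ x) /cards1P[e he]; exists e; apply/eqP.
have : e \in [set c | T c == x] by rewrite he inE.
by rewrite inE.
Qed.

Lemma column_colouringE c : column_colouring T (T c) = (val c).2.
Proof.
rewrite ffunE; case: pickP => [d /eqP /standard_inj -> //|/(_ c)].
by rewrite eqxx.
Qed.

Lemma cls_column_colouring (j : 'I_n) : cls (column_colouring T) j = column T j.
Proof.
apply/setP => x; rewrite inE; have [c <-] := standard_surj x.
rewrite column_colouringE; apply/eqP/imsetP => [h|[d]].
  by exists c => //; rewrite inE /col_of h.
by rewrite inE /col_of => /eqP h /standard_inj ->; apply: val_inj.
Qed.

Lemma inv_column_colouring :
  inv_coloring (inc P) (column_colouring T) = inv_tableau P T.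
Proof.
apply: eq_card => -[x y]; rewrite !inE /=.
congr [&& _, _ & _]; have [c <-] := standard_surj x; have [d <-] := standard_surj y.
rewrite !column_colouringE; apply/idP/existsP => [h|[c' /existsP[d']]].
  by exists c; apply/existsP; exists d; rewrite !eqxx.
by case/and3P => /eqP /standard_inj -> /eqP /standard_inj -> h.
Qed.

Hypothesis hPT : is_Ptableau P T.

Lemma Ptableau_column c d :
  col_of c = col_of d -> (row_of c < row_of d)%N -> P (T c) (T d).
Proof.
move=> hc /subnKC; move: (row_of d - (row_of c).+1)%N => m hm.
elim: m d hc hm => [|m IHm] d hc hm.
  move/forallP: hPT => /(_ c) /forallP /(_ d) /andP[/implyP h _]; apply: h.
  by rewrite -hm addn0 hc !eqxx.
have [e [he1 he2]] : exists e : cell la,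
    row_of e = ((row_of c).+1 + m)%N /\ col_of e = col_of d.
  by apply: cell_exists; apply: leq_trans (row_lt_conj d); rewrite -hm addnS.
have hce : P (T c) (T e) by apply: IHm; rewrite ?he2.
apply: (P_mono hP (leqnn _) _ hce); apply/ltnW/(P_lt hP).
move/forallP: hPT => /(_ e) /forallP /(_ d) /andP[/implyP h _]; apply: h.
by rewrite he1 -hm addnS he2 !eqxx.
Qed.

Lemma proper_column_colouring : proper_coloring (inc P) (column_colouring T).
Proof.
apply/forallP => x; apply/forallP => y; apply/implyP.
have [c <-] := standard_surj x; have [d <-] := standard_surj y.
rewrite !column_colouringE; apply: contraL => /eqP h.
have hcol : col_of c = col_of d by rewrite /col_of h.
case: (ltngtP (row_of c) (row_of d)) => hr.
- by rewrite /inc Ptableau_column // andbF.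
- by rewrite /inc (Ptableau_column (esym hcol) hr) !andbF.
by rewrite (cell_eq hr hcol) /inc eqxx.
Qed.

Lemma content_column_colouring : content (column_colouring T) = conj_mnm la.
Proof.
apply/mnmP => j; rewrite content_cls cls_column_colouring mnmE /column.
rewrite card_imset; last exact: standard_inj.
rewrite -[RHS](minn_idPr (conj_part_le la j)) -card_cells.
by apply: eq_card => c; rewrite !inE row_lt andbT.
Qed.

Lemma cls_rank_column_colouring c : cls_rank (column_colouring T) (T c) = row_of c.
Proof.
rewrite -[RHS](minn_idPl (ltnW (row_lt_conj c))) -card_cells /cls_rank.
rewrite -(card_imset _ standard_inj); apply: eq_card => y; rewrite inE.
have [d <-] := standard_surj y; rewrite (mem_imset _ _ standard_inj) inE.
rewrite !column_colouringE -val_eqE /= -/(col_of d) -/(col_of c).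
case: eqP => //= hcol; apply/idP/idP; last first.
  by move=> /(Ptableau_column hcol) /(P_lt hP).
move=> hlt; case: (ltngtP (row_of d) (row_of c)) => // hr.
  by have := P_lt hP (Ptableau_column (esym hcol) hr); rewrite ltnNge (ltnW hlt).
by move: hlt; rewrite (cell_eq hr hcol) ltnn.
Qed.

Lemma sorted_filling_column_colouring : sorted_filling (column_colouring T) = T.
Proof.
apply/ffunP => c; rewrite ffunE; case: pickP => [x|/(_ (T c))]; last first.
  by rewrite column_colouringE cls_rank_column_colouring !eqxx.
have [d <-] := standard_surj x.
rewrite column_colouringE cls_rank_column_colouring => /andP[/eqP h1 /eqP h2].
by rewrite /= (@cell_eq d c) // /col_of h1.
Qed.

Lemma strong_column_colouring : is_strong P T -> strong_colouring (column_colouring T).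
Proof.
move=> hs; rewrite /strong_colouring proper_column_colouring.
rewrite content_column_colouring eqxx /=; apply/forallP => i; apply/forallP => i'.
apply/implyP => /eqP hi; rewrite -subset0; apply/subsetP => L; rewrite inE.
rewrite laddersC !cls_column_colouring hi => /andP[hL hlt].
by move/forallP: hs => /(_ i) /forall_inP /(_ L hL); rewrite /right_unbalanced hlt.
Qed.

End FromTableau.

Section FromColouring.
Variable kappa : {ffun 'I_n -> 'I_n}.
Hypothesis hk : strong_colouring kappa.

Let hproper : proper_coloring (inc P) kappa. Proof. by case/and3P: hk. Qed.

Let hcontent j : #|cls kappa j| = conj_part la j.
Proof. by case/and3P: hk => _ /eqP /mnmP /(_ j); rewrite content_cls mnmE. Qed.

Let hexcess (i i' : 'I_n) : i' = i.+1 :> nat -> excess P i' i kappa = set0.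
Proof.
move=> h; case/and3P: hk => _ _ /forallP /(_ i) /forallP /(_ i') /implyP.
by rewrite h eqxx => /(_ isT) /eqP.
Qed.

Lemma cls_rank_lt (x y : 'I_n) : kappa x = kappa y -> (x < y)%N ->
  (cls_rank kappa x < cls_rank kappa y)%N.
Proof.
move=> h hxy; apply/proper_card/properP; split.
  by apply/subsetP => z; rewrite !inE h => /andP[-> /ltn_trans ->].
by exists x; rewrite !inE ?h ?eqxx ?ltnn.
Qed.

Lemma cls_rank_inj x y : kappa x = kappa y ->
  cls_rank kappa x = cls_rank kappa y -> x = y.
Proof.
move=> h hr; case: (ltngtP x y) => [hlt|hlt|/val_inj //].
  by have := cls_rank_lt h hlt; rewrite hr ltnn.
by have := cls_rank_lt (esym h) hlt; rewrite hr ltnn.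
Qed.

Lemma cls_rank_bound x : (cls_rank kappa x < #|cls kappa (kappa x)|)%N.
Proof.
apply/proper_card/properP; split; first by apply/subsetP => z; rewrite !inE => /andP[].
by exists x; rewrite !inE ?eqxx ?ltnn.
Qed.

Lemma cls_rank_n x : (cls_rank kappa x < n)%N.
Proof.
by apply: leq_trans (cls_rank_bound x) _; rewrite hcontent conj_part_le.
Qed.

Lemma cls_rank_onto (j : 'I_n) (r : nat) : (r < #|cls kappa j|)%N ->
  exists x, kappa x = j /\ cls_rank kappa x = r.
Proof.
move=> hr; have hn : (#|cls kappa j| <= n)%N by rewrite hcontent conj_part_le.
pose rk x := Ordinal (cls_rank_n x).
have hE : rk @: cls kappa j = [set l : 'I_n | (l < #|cls kappa j|)%N].
  apply/eqP; rewrite eqEcard card_ltn // card_in_imset ?leqnn ?andbT.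
    by apply/subsetP => _ /imsetP[x hx ->]; rewrite inE; move: hx (cls_rank_bound x);
       rewrite inE => /eqP ->.
  move=> x y; rewrite !inE => /eqP hx /eqP hy /(congr1 val) /= h.
  by apply: cls_rank_inj; rewrite ?hx ?hy.
have : Ordinal (leq_trans hr hn) \in rk @: cls kappa j by rewrite hE inE.
by case/imsetP => x; rewrite inE => /eqP hx /(congr1 val) /= h; exists x.
Qed.

Let T := sorted_filling kappa.

Lemma sorted_fillingP c : kappa (T c) = (val c).2 /\ cls_rank kappa (T c) = row_of c.
Proof.
have [x [h1 h2]] : exists x, kappa x = (val c).2 /\ cls_rank kappa x = row_of c.
  by apply: cls_rank_onto; rewrite hcontent; apply: row_lt_conj.
rewrite /T ffunE; case: pickP => [y /andP[/eqP-> /eqP->] //|/(_ x)].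
by rewrite h1 h2 !eqxx.
Qed.

Lemma sorted_filling_inj : injective T.
Proof.
move=> c d h; have [h1 h2] := sorted_fillingP c; have [h3 h4] := sorted_fillingP d.
by apply: cell_eq; rewrite /col_of -?h2 -?h4 -?h1 -?h3 h.
Qed.

Lemma sorted_filling_surj x : exists c, T c = x.
Proof.
have [|c [hr hc]] := @cell_exists (cls_rank kappa x) (kappa x).
  by rewrite -hcontent cls_rank_bound.
exists c; have [h1 h2] := sorted_fillingP c; apply: cls_rank_inj; last by rewrite h2.
by rewrite h1; apply: val_inj.
Qed.

Lemma sorted_filling_standard : is_standard T.
Proof.
apply/forallP => x; have [c hc] := sorted_filling_surj x; apply/cards1P; exists c.
apply/setP => d; rewrite !inE -hc; exact: (inj_eq sorted_filling_inj).
Qed.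

Lemma column_colouring_sorted_filling : column_colouring T = kappa.
Proof.
apply/ffunP => x; have [c <-] := sorted_filling_surj x.
rewrite (column_colouringE sorted_filling_standard).
by have [-> _] := sorted_fillingP c.
Qed.

Lemma sorted_filling_cls (j : 'I_n) : column T j = cls kappa j.
Proof.
rewrite -(cls_column_colouring sorted_filling_standard).
by rewrite column_colouring_sorted_filling.
Qed.

(** The row condition. If T d <_P T c for adjacent cells c, d of row r, the
    matching of the right column into the left one sends the r + 1 elements up to
    [T d] to elements incomparable to some y <= T d, hence among the r elements
    that precede [T c]. *)
Lemma sorted_filling_Ptableau : is_Ptableau P T.
Proof.
apply/forallP => c; apply/forallP => d; have [h1 h2] := sorted_fillingP c.
have [h3 h4] := sorted_fillingP d.
apply/andP; split; apply/implyP => /andP[/eqP hr /eqP hc].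
  have hcd : kappa (T c) = kappa (T d) by rewrite h1 h3; apply/val_inj.
  apply: (chain_lt hP (cls_chain (kappa (T c)) hproper)); rewrite ?inE ?hcd //.
  rewrite ltnNge; apply/negP; rewrite leq_eqVlt => /orP[/eqP/val_inj h|h].
    by move: h4; rewrite h h2 hr => /n_Sn.
  by have := cls_rank_lt (esym hcd) h; rewrite h2 h4 hr ltnNge leqnSn.
apply/negP => hdc.
set a := kappa (T c) in h1; set b := kappa (T d) in h3.
have hab : b = a.+1 :> nat by rewrite h1 h3.
have hab' : a != b by rewrite -val_eqE /= hab neq_ltn ltnSn.
have [|f [finj hf]] := matching_of_balanced hP (cls_chain a hproper)
    (cls_chain b hproper) (cls_disjoint kappa hab').
  move=> L hL; rewrite leqNgt; apply/negP => hlt.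
  by have /setP /(_ L) := hexcess hab; rewrite !inE laddersC hL hlt.
(* The elements of the right column up to T d. *)
pose D := T d |: [set y | (kappa y == kappa (T d)) && (y < T d)%N].
have hD y : y \in D -> y \in cls kappa b /\ (y <= T d)%N.
  rewrite !inE => /orP[/eqP->|/andP[/eqP-> /ltnW-> //]]; split=> //.
have : (#|f @: D| <= cls_rank kappa (T c))%N.
  apply: subset_leq_card; apply/subsetP => _ /imsetP[y /hD[hy hyd] ->].
  have [hfy hi] := hf y hy; rewrite !inE in hfy *; rewrite hfy /=.
  rewrite ltnNge; apply/negP => hle.
  by move: hi; rewrite /inc (P_mono hP hyd hle hdc) andbF.
rewrite card_in_imset; last first.
  by move=> y y' /hD[hy _] /hD[hy' _]; apply: finj.
rewrite cardsU1 inE ltnn andbF add1n -/(cls_rank kappa (T d)) h2 h4 hr.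
by rewrite ltnn.
Qed.

Lemma sorted_filling_strong : is_strong P T.
Proof.
apply/forallP => j; apply/forall_inP => L; rewrite /right_unbalanced.
case: (ltnP j.+1 n) => hj; last first.
  have -> : column T j.+1 = set0.
    apply/setP => x; rewrite inE; apply/negP => /imsetP[c]; rewrite inE => /eqP hc.
    by have := ltn_ord (val c).2; rewrite -/(col_of c) hc ltnNge hj.
  by rewrite setI0 cards0 ltn0.
rewrite sorted_filling_cls -[j.+1]/(val (Ordinal hj)) sorted_filling_cls => hL.
apply/negP => hlt; have /setP /(_ L) := hexcess (erefl : Ordinal hj = j.+1 :> nat).
by rewrite !inE laddersC hL hlt.
Qed.

End FromColouring.

Lemma sum_strong_colourings :
  \sum_(kappa | strong_colouring kappa) 'X^(inv_coloring (inc P) kappa) =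
  \sum_(T in strongST P la) 'X^(inv_tableau P T) :> {poly int}.
Proof.
rewrite (reindex_onto column_colouring sorted_filling) => [|kappa hk]; last first.
  exact: column_colouring_sorted_filling.
apply: eq_big => [T|T /andP[hk /eqP hT]]; last first.
  by rewrite inv_column_colouring // -hT; apply: sorted_filling_standard.
rewrite inE; apply/andP/and3P => [[hk /eqP <-]|[h1 h2 h3]].
  split; [exact: sorted_filling_Ptableau | exact: sorted_filling_standard |].
  exact: sorted_filling_strong.
by rewrite strong_column_colouring ?sorted_filling_column_colouring.
Qed.

End StrongTableaux.

(** * The greedy partition bounds every colouring *)

Section Greedy.
Variables (n : nat) (P : rel 'I_n).

Lemma psum_part (mu : intpart n) (k : nat) : (k <= n)%N ->
  (\sum_(r < k) part mu r = \sum_(j < n) minn (conj_part mu j) k)%N.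
Proof.
move=> hk; transitivity (\sum_(r < k) \sum_(j < n) (j < part mu r))%N.
  by apply: eq_bigr => r _; rewrite sum_ltn_minn; apply/esym/minn_idPl/part_le.
rewrite exchange_big /=; apply: eq_bigr => j _.
by under eq_bigr do rewrite ltn_part; rewrite sum_ltn_minn.
Qed.

Lemma sorted_intpart (t : 'I_n -> nat) : (\sum_l t l)%N = n ->
  exists2 nu : intpart n,
    perm_eq (parts nu) [seq m <- [seq t l | l <- enum 'I_n] | (0 < m)%N] &
    forall j, conj_part nu j = #|[set l | (j < t l)%N]|.
Proof.
move=> ht; set u := [seq t l | l <- enum 'I_n].
have hle m : m \in u -> (m < n.+1)%N.
  by case/mapP => l _ ->; rewrite ltnS -[X in (_ <= X)%N]ht (bigD1 l) //= leq_addr.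
have hsize : size [seq inord m : 'I_n.+1 | m <- sort geq u] == n.
  by rewrite size_map size_sort size_map size_enum_ord.
have hval : [seq val x | x <- [seq inord m : 'I_n.+1 | m <- sort geq u]] = sort geq u.
  rewrite -map_comp -[RHS]map_id; apply/eq_in_map => m.
  by rewrite mem_sort => /hle hm /=; rewrite inordK.
have hpart : is_intpart (Tuple hsize).
  apply/andP; split; first by rewrite hval sort_sorted // => x y; apply: leq_total.
  rewrite -(big_map val xpredT id) hval (perm_big u) /=; last by rewrite perm_sort.
  by rewrite big_map big_enum /= ht.
have hperm : perm_eq (parts (IntPart hpart)) [seq m <- u | (0 < m)%N].
  rewrite /parts -(filter_map val (fun m => 0 < m)%N) hval.
  by apply: perm_filter; rewrite perm_sort.
exists (IntPart hpart) => // j; rewrite /conj_part (seq.permP hperm) count_filter.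
rewrite count_map cardsE cardE [X in _ = size X]/enum_mem -enumT size_filter.
apply: eq_count => l /=; rewrite -[RHS]/(j < t l)%N; case: (ltnP j (t l)) => //=.
by move=> /(leq_ltn_trans (leq0n j)) ->.
Qed.

(** Any [k] of the values sum to at most the [k] largest; both sums are taken by
    layers, the layer [j] counting the values greater than [j]. *)
Lemma psum_sorted (t : 'I_n -> nat) (nu : intpart n) (k : nat) : (k <= n)%N ->
  (\sum_l t l)%N = n ->
  (forall j, conj_part nu j = #|[set l | (j < t l)%N]|) ->
  (\sum_(l < n | (l < k)%N) t l <= \sum_(r < k) part nu r)%N.
Proof.
move=> hk ht hnu; rewrite psum_part //.
have -> : (\sum_(l < n | (l < k)%N) t l =
           \sum_(l < n | (l < k)%N) \sum_(j < n) (j < t l))%N.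
  apply: eq_bigr => l _; rewrite sum_ltn_minn; apply/esym/minn_idPl.
  by rewrite -[X in (_ <= X)%N]ht (bigD1 l) //= leq_addr.
rewrite exchange_big /=; apply: leq_sum => j _; rewrite leq_min hnu; apply/andP; split.
  rewrite -sum1dep_card [leqRHS]big_mkcond [leqLHS]big_mkcond /=.
  by apply: leq_sum => l _; case: ifP => // _; case: ifP.
rewrite -[X in (_ <= X)%N](card_ltn hk) -sum1dep_card.
by apply: leq_sum => l _; case: (_ < _)%N.
Qed.

Lemma sum_content (kappa : {ffun 'I_n -> 'I_n}) : (\sum_l content kappa l)%N = n.
Proof.
under eq_bigr do rewrite content_cls -sum1dep_card.
rewrite (exchange_big_dep xpredT) //= -[RHS]card_ord -sum1_card.
apply: eq_bigr => x _; under eq_bigl do rewrite eq_sym.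
by rewrite big_pred1_eq.
Qed.

(** The colour classes are a partition into chains, and the greedy partition
    dominates their sizes. *)
Lemma greedy_bound (lgr : intpart n) (kappa : {ffun 'I_n -> 'I_n}) (k : nat) :
  greedy_partition P lgr -> proper_coloring (inc P) kappa -> (k <= n)%N ->
  (\sum_(l < n | (l < k)%N) content kappa l <= \sum_(l < k) part lgr l)%N.
Proof.
move=> [_ hgr] hk hkn.
have [nu hperm hconj] := sorted_intpart (sum_content kappa).
apply: leq_trans (psum_sorted hkn (sum_content kappa) hconj) (hgr nu _ k).
have hmem A : (A \in preim_partition kappa [set: 'I_n]) =
   (A \in [seq cls kappa a | a <- enum 'I_n & (0 < #|cls kappa a|)%N]).
  apply/imsetP/mapP => [[x _ ->]|[a]].
    exists (kappa x); last by apply/setP => y; rewrite !inE eq_sym.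
    by rewrite mem_filter mem_enum andbT; apply/card_gt0P; exists x; rewrite inE.
  rewrite mem_filter => /andP[/card_gt0P[x]]; rewrite inE => /eqP hx _ ->.
  by exists x => //; apply/setP => y; rewrite !inE hx eq_sym.
exists (preim_partition kappa [set: 'I_n]); split.
- exact: preim_partitionP.
- by move=> A; rewrite hmem => /mapP[a _ ->]; apply: cls_chain.
rewrite perm_sym; apply: perm_trans hperm _; rewrite filter_map.
have -> : [seq #|A| | A : {set 'I_n} <- enum (preim_partition kappa [set: 'I_n])] =
   map (fun A : {set 'I_n} => #|A|) (enum (preim_partition kappa [set: 'I_n])) by [].
have hE : [seq content kappa l | l <- enum 'I_n & (0 < content kappa l)%N] =
   map (fun A : {set 'I_n} => #|A|)
     [seq cls kappa a | a <- enum 'I_n & (0 < #|cls kappa a|)%N].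
  rewrite -map_comp; have -> : [seq l <- enum 'I_n | (0 < content kappa l)%N] =
     [seq a <- enum 'I_n | (0 < #|cls kappa a|)%N].
    by apply: eq_filter => l; rewrite content_cls.
  by apply: eq_map => l /=; rewrite content_cls.
rewrite [X in perm_eq X]hE; apply: perm_map; apply: uniq_perm.
- rewrite map_inj_in_uniq => [|a b]; first by rewrite filter_uniq // enum_uniq.
  rewrite mem_filter => /andP[/card_gt0P[x hx] _] _ /setP /(_ x).
  by move: hx; rewrite !inE => /eqP ->; rewrite eqxx => /esym/eqP.
- exact: enum_uniq.
by move=> A; rewrite mem_enum hmem.
Qed.

End Greedy.

(** * Comparing the two expansions *)

Lemma poly_int_torsion_free (k : nat) : injective (fun p : {poly int} => p *+ k.+1).
Proof.
move=> p q /= /eqP; rewrite -subr_eq0 -mulrnBl -mulr_natr mulf_eq0 => /orP[|].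
  by rewrite subr_eq0 => /eqP.
by rewrite -polyC_natr polyC_eq0 pnatr_eq0.
Qed.

Section Comparison.
Variables (n : nat) (P : rel 'I_n).
Hypothesis hP : staircase P.
Variable c : intpart n -> {poly int}.
Hypothesis hc : e_coefficients (chromatic_qsym (inc P)) c.

Definition succ_ord (i : 'I_n) : 'I_n := insubd i i.+1.

Lemma succ_ordE (i : 'I_n) : (i.+1 < n)%N -> succ_ord i = i.+1 :> nat.
Proof. by move=> hi; rewrite val_insubd hi. Qed.

(** The restrictions at the elements of [s] are imposed one at a time, by
    [flip_sum_determined]: flips at [i] keep those already imposed, because the
    pairs {i, i+1} for i in [s] are disjoint. *)
Lemma restricted_sums (s : seq 'I_n) :
  uniq s -> {in s, forall i : 'I_n, (i.+1 < n)%N} ->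
  {in s &, forall i j : 'I_n, j <> i.+1 :> nat} ->
  forall nu : 'X_{1..n},
  \sum_(kappa | (proper_coloring (inc P) kappa &&
                 all (fun i => excess P (succ_ord i) i kappa == set0) s)
                && (content kappa == nu)) 'X^(inv_coloring (inc P) kappa) =
  \sum_(z | all (fun i => mxexcess (succ_ord i) i z == set0) s &&
            (mxcontent z == nu)) \sum_(mu | row_sums z mu) c mu.
Proof.
elim: s => [|i s IHs] /= => [_ _ _ nu|].
  by under eq_bigl do rewrite andbT; apply: e_coefficients_contents.
case/andP=> his hs hlast hadj nu.
have hin := succ_ordE (hlast i (mem_head i s)).
have disjoint_pairs j : j \in s ->
    [/\ succ_ord j != succ_ord i, succ_ord j != i, j != succ_ord i & j != i].
  move=> hj; have hj' : j \in i :: s by rewrite inE hj orbT.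
  have hjn := succ_ordE (hlast j hj').
  have := hadj i j (mem_head i s) hj'; have := hadj j i hj' (mem_head i s).
  rewrite -!val_eqE /= hin hjn => /eqP h1 /eqP h2; rewrite eqSS h2 [j.+1 == _]eq_sym h1.
  by have -> : (j != i :> nat); [apply: contraNneq his => /val_inj <- | ].
have hne : i != succ_ord i by rewrite -val_eqE /= hin neq_ltn ltnSn.
pose good1 (kappa : {ffun 'I_n -> 'I_n}) := proper_coloring (inc P) kappa &&
  all (fun i => excess P (succ_ord i) i kappa == set0) s.
pose good2 (z : {ffun 'I_n -> {set 'I_n}}) :=
  all (fun i => mxexcess (succ_ord i) i z == set0) s.
have hsub : {subset s <= i :: s} by move=> j hj; rewrite inE hj orbT.
have fs1 := @colouring_flip_system n P hP i (succ_ord i) good1 hin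
  (fun kappa h => proj1 (andP h)).
have := @flip_sum_determined n i (succ_ord i) _ _ _ _ _ _ _ _ _ _ _ _ _ _ _ _ _ hne
  poly_int_torsion_free (fs1 _)
  (@mx_flip_system n i (succ_ord i) _ good2 _ _ _) (IHs hs _ _) nu.
move=> H; etransitivity; last (etransitivity; first apply: H).
- by apply: eq_bigl => kappa; rewrite /good1 -!andbA [X in _ && X]andbCA.
- move=> kappa L hL /andP[hk hall]; rewrite /good1 (proper_cflip hL hk) /=.
  apply/allP => j hj; have [h1 h2 h3 h4] := disjoint_pairs j hj.
  by rewrite excess_flip_disjoint //; apply: (allP hall).
- move=> z r hall; apply/allP => j hj; have [h1 h2 h3 h4] := disjoint_pairs j hj.
  by rewrite mxexcess_flip_disjoint //; apply: (allP hall).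
- by move=> z r; apply: eq_bigl => mu; rewrite row_sums_mxflip.
- by move=> j /hsub; apply: hlast.
- by move=> j l /hsub hj /hsub; apply: hadj.
by apply: eq_bigl => z; rewrite /good2 [X in X && _]andbC.
Qed.

End Comparison.

Section GreedyShape.
Variables (n : nat) (P : rel 'I_n).
Hypothesis hP : staircase P.
Variable lgr : intpart n.
Hypothesis hgr : greedy_partition P lgr.
Variable la : intpart n.

(** Flipping a right-unbalanced ladder moves one element from colour i + 1 to
    colour [i], and the first i + 1 classes would exceed the greedy bound. *)
Lemma greedy_excess (kappa : {ffun 'I_n -> 'I_n}) (i i' : 'I_n) : i' = i.+1 :> nat ->
  proper_coloring (inc P) kappa -> content kappa = conj_mnm la ->
  (\sum_(l < i.+1) conj_part la l = \sum_(l < i.+1) part lgr l)%N ->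
  excess P i' i kappa = set0.
Proof.
move=> hi hk hcont hsum; apply/setP => L; rewrite [RHS]inE; apply/negP => hL.
have hne : i' != i by rewrite -val_eqE /= hi neq_ltn ltnSn orbT.
have := content_cflip hP hne hk hL.
have hk' : proper_coloring (inc P) (cflip i' i kappa L).
  by apply: proper_cflip hk => //; move: hL; rewrite inE => /andP[].
have := greedy_bound hgr hk' (ltn_ord i); rewrite -hsum -psum_conj_mnm // -hcont.
move: (cflip _ _ _ _) => kappa' hle /mnmP hE; move: hle.
rewrite leqNgt => /negP; apply; rewrite (bigD1 i) //= [X in (_ < X)%N](bigD1 i) //=.
have hEi : content kappa' i = (content kappa i).+1.
  by have := hE i; rewrite !mnmDE !mnm1E eqxx (negbTE hne) addn0 addn1.
rewrite hEi addSn ltnS leq_add2l; apply: leq_sum => l /andP[hl hli].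
have hli' : (i' == l) = false by rewrite -val_eqE /= hi gtn_eqF.
by have := hE l; rewrite !mnmDE !mnm1E [i == l]eq_sym (negbTE hli) hli' !addn0 => ->.
Qed.

Variable c : intpart n -> {poly int}.
Hypothesis hc : e_coefficients (chromatic_qsym (inc P)) c.

Lemma e_coefficient_support mu (k : nat) : (k <= n)%N -> c mu != 0 ->
  (\sum_(l < k) conj_part mu l <= \sum_(l < k) part lgr l)%N.
Proof.
move=> hk; apply: coefficient_support hk => nu {}k hk hlt.
rewrite -(e_coefficients_contents nu hc) big_pred0 // => kappa.
apply/andP => -[hkap /eqP hnu]; have := greedy_bound hgr hkap hk.
by rewrite hnu leqNgt hlt.
Qed.

(** Outside [S] the partial sums of the conjugate of [la] are as large as the
    greedy bound allows. There a colouring has no right-unbalanced ladder and a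
    contributing matrix no row 01, so the restrictions at [S] alone leave the strong
    colourings on one side and the left-justified matrix of [la] on the other. *)
Lemma near_greedy_coefficient (S : {set 'I_n}) :
  {in S, forall i : 'I_n, (i.+1 < n)%N} ->
  {in S &, forall i j : 'I_n, j <> i.+1 :> nat} ->
  (forall i : 'I_n, i \notin S ->
     (\sum_(l < i.+1) conj_part la l = \sum_(l < i.+1) part lgr l)%N) ->
  c la = \sum_(T in strongST P la) 'X^(inv_tableau P T).
Proof.
move=> hlast hadj hsum; rewrite -sum_strong_colourings //.
have hex (i i' : 'I_n) (E : 'I_n -> 'I_n -> bool) : i' = i.+1 :> nat ->
    all (fun i => E (succ_ord i) i) (enum S) -> i \in S -> E i' i.
  move=> hi /allP /(_ i); rewrite mem_enum => h hiS.
  by have -> : i' = succ_ord i; [apply/val_inj; rewrite /= succ_ordE ?hlast | apply: h].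
transitivity (\sum_(kappa | (proper_coloring (inc P) kappa &&
                 all (fun i => excess P (succ_ord i) i kappa == set0) (enum S))
                && (content kappa == conj_mnm la)) 'X^(inv_coloring (inc P) kappa)
              : {poly int}); last first.
  apply: eq_bigl => kappa; rewrite /strong_colouring -andbA.
  have [hk|//] := boolP (proper_coloring (inc P) kappa).
  rewrite /= andbC; case: eqP => //= hcont; apply/idP/idP.
    move=> hall; apply/forallP => i; apply/forallP => i'; apply/implyP => /eqP hi.
    have [hiS|hiS] := boolP (i \in S).
      exact: (hex i i' (fun a b => excess P a b kappa == set0) hi hall hiS).
    by rewrite (greedy_excess hi) ?hsum.
  move=> /forallP h; apply/allP => i; rewrite mem_enum => /hlast /succ_ordE hi.
  by have /forallP /(_ (succ_ord i)) := h i; rewrite hi eqxx.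
rewrite (restricted_sums hP hc) ?enum_uniq //; first last.
- by move=> i j; rewrite !mem_enum; apply: hadj.
- by move=> i; rewrite mem_enum; apply: hlast.
rewrite extract_coefficient //.
  apply/allP => i; rewrite mem_enum => /hlast /succ_ordE hi.
  by rewrite mxexcess_justified.
move=> z mu hall hcont hz; apply: contraNeq => hmu; apply/eqP/conj_mnm_inj.
rewrite -hcont -mxcontent_justified; congr mxcontent; apply/esym/eq_justified => //.
move=> i i' hi; have [hiS|hiS] := boolP (i \in S).
  exact/eqP/(hex i i' (fun a b => mxexcess a b z == set0) hi hall hiS).
apply: (mxexcess_extremal hi hz); rewrite hcont psum_conj_mnm // hsum //.
exact: e_coefficient_support.
Qed.

End GreedyShape.

Theorem theorem1p8 (R : realType) (n : nat) (P : rel 'I_n)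
    (hP : natural_unit_interval_order R P)
    (c : intpart n -> {poly int})
    (hc : e_coefficients (chromatic_qsym (inc P)) c)
    (lgr : intpart n) (hlgr : greedy_partition P lgr)
    (S : {set 'I_n})
    (hS : forall i j : 'I_n, i \in S -> j \in S -> (j : nat) <> i.+1)
    (k : 'I_n -> nat) (hk : forall i : 'I_n, i \in S -> (0 < k i)%N)
    (la : intpart n)
    (hla_S : forall i : 'I_n, i \in S ->
       (conj_part la i)%:Z = (part lgr i)%:Z - (k i)%:Z)
    (hla_succ : forall i : 'I_n, i \in S ->
       conj_part la i.+1 = (part lgr i.+1 + k i)%N)
    (hla_other : forall j : nat,
       (forall i : 'I_n, i \in S -> j <> i /\ j <> i.+1) ->
       conj_part la j = part lgr j) :
  c la = \sum_(T in strongST P la) 'X^(inv_tableau P T).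
Proof.
(* Column i + 1 of la has at least k i > 0 cells, so i + 1 < n. *)
have hlast : {in S, forall i : 'I_n, (i.+1 < n)%N}.
  move=> i hi; rewrite ltnNge; apply/negP => hn.
  have := hla_succ i hi; rewrite conj_part_gt // => /esym/eqP.
  by rewrite addn_eq0 -[k i == 0%N]negbK -lt0n hk // andbF.
apply: (near_greedy_coefficient (natural_staircase hP) hlgr hc hlast).
  by move=> i j; apply: hS.
(* The two partial sums differ only just after an element i of S, by k i. *)
have hsum m : (m <= n)%N -> (\sum_(l < m) (conj_part la l)%:Z =
    \sum_(l < m) (part lgr l)%:Z -
    (if [pick i : 'I_n | (i \in S) && (m == i.+1)] is Some i then (k i)%:Z else 0)).
  elim: m => [|m IHm] hm.
    by rewrite !big_ord0; case: pickP => [x|]; rewrite ?andbF ?subr0.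
  rewrite !big_ord_recr /= IHm 1?ltnW //.
  case: pickP => [i /andP[hi /eqP hmi]|hno].
    subst m; rewrite hla_succ //.
    case: pickP => [j /andP[hj /eqP [hji]]|_]; first by case: (hS i j hi hj).
    by rewrite subr0 PoszD [(_ + Posz (k i))%R]addrC addrA subrK.
  case: pickP => [i /andP[hi /eqP [hmi]]|hno'].
    by rewrite hmi hla_S // subr0 addrA.
  rewrite hla_other ?subr0 // => i hi; split=> hmi.
    by have := hno' i; rewrite hi hmi eqxx.
  by have := hno i; rewrite hi hmi eqxx.
move=> i hi; have := hsum i.+1 (ltn_ord i).
case: pickP => [j /andP[hj /eqP [/val_inj hij]]|_]; first by rewrite hij hj in hi.
by rewrite subr0 -!(big_morph Posz PoszD (erefl 0%:Z)) => -[].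
Qed.
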